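(* Assume that $F:\Omega\times X\to\mathbb{R}^m$ is continuous, of class $C^1$ with respect to the second variable, that $F(\Omega\times X_1)$ is bounded in $\mathbb{R}^m$ for every bounded set $X_1\subset X$, and that $$F(\omega,\psi)-F(\omega,\phi)\geq B\,(\psi(0)-\phi(0))\quad\text{whenever }\phi\leq_B\psi \text{ and }\omega\in\Omega.$$ Let $\widetilde a:\Omega\to\mathbb{R}^m$ be $C^1$ along the trajectories of the base flow, and define $a:\Omega\to X$ by $a(\omega)(s)=\widetilde a(\omega\cdot s)$, $s\in[-r,0]$. Then: (i) The map $a$ is a sub-equilibrium for the exponential ordering provided that for each $\omega\in\Omega$, $y(t,\omega,a(\omega))$ is defined for all $t\ge0$ and $$\widetilde a'(\omega)\le F(\omega,a(\omega)).$$ (ii) If the conditions in (i) hold, if $$F(\omega,\psi)-F(\omega,\phi)\gg B\,(\psi(0)-\phi(0))\quad\text{whenever } \phi\leq_B\psi,\ \phi\ll\psi \text{ and } \omega\in\Omega,$$ and if there is an $\omega_0\in\Omega$ which is simultaneously a continuity point of $a$ and of $a\circ\sigma_{s_*}$, for some $s_*\ge3r$, such that $$\widetilde a'(\omega_0)\ll F(\omega_0,a(\omega_0)),$$ then $a$ is a strong sub-equilibrium for the exponential ordering.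
   Context: $\Omega$ is a compact metric space with a continuous minimal flow $\sigma:\mathbb{R}\times\Omega\to\Omega$, $\sigma_t(\omega)=\sigma(t,\omega)=\omega\cdot t$. Fix $r>0$, $m\ge 1$. $X=C([-r,0],\mathbb{R}^m)$ with the sup-norm $\|\varphi\|_\infty=\sup_{s\in[-r,0]}\|\varphi(s)\|$, where $\|\cdot\|$ is the maximum norm on $\mathbb{R}^m$. For a continuous $y:[-r,\infty)\to\mathbb{R}^m$ and $t\ge0$, $y_t\in X$ is $y_t(s)=y(t+s)$, $s\in[-r,0]$. For $y\in\mathbb{R}^m$, $y\ge0$ (resp. $y\gg0$) means all components are nonnegative (resp. positive). For $\phi,\psi\in X$: $\phi\le\psi$ means $\psi(s)-\phi(s)\ge 0$ for all $s\in[-r,0]$, and $\phi\ll\psi$ means $\psi(s)-\phi(s)\gg0$ for all $s\in[-r,0]$. $B=[b_{ij}]$ is a fixed real $m\times m$ quasipositive matrix ($b_{ij}\ge0$ for $i\ne j$). The exponential ordering is given by the cone $K_B=\{\phi\in X\mid \phi\ge0,\ \phi(t)\ge e^{B(t-s)}\phi(s)\text{ for } -r\le s\le t\le0\}$: $\phi\le_B\psi$ iff $\psi-\phi\in K_B$. $X_L\subset X$ is the Banach space of Lipschitz functions with norm $\|\phi\|_L=\|\phi\|_\infty+\sup\{\|\phi(t)-\phi(s)\|/|t-s| : s\ne t\in[-r,0]\}$; $\widetilde K_B=K_B\cap X_L$, whose interior in $X_L$ is $\operatorname{Int}\widetilde K_B=\{\phi\in X_L\mid \phi\gg0 \text{ and,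 for some }\varepsilon>0,\ \phi'-B\phi\ge(\varepsilon,\dots,\varepsilon)\text{ a.e. on }[-r,0]\}$. We write $\phi\ll_B\psi$ iff $\psi-\phi\in\operatorname{Int}\widetilde K_B$. For $\omega\in\Omega$, $\varphi\in X$, $y(t,\omega,\varphi)$ denotes the (locally defined, unique) solution of $y'(t)=F(\omega\cdot t,y_t)$, $t\ge0$, with $y(s,\omega,\varphi)=\varphi(s)$ for $s\in[-r,0]$, and $y_t(\omega,\varphi)\in X$ is $y_t(\omega,\varphi)(s)=y(t+s,\omega,\varphi)$. A map $\widetilde a:\Omega\to\mathbb{R}^m$ is $C^1$ along the trajectories of the base flow if for each $\omega\in\Omega$ the map $\mathbb{R}\to\mathbb{R}^m$, $t\mapsto\widetilde a(\omega\cdot t)$ is of class $C^1$; then $\widetilde a'(\omega)=\frac{d}{dt}\widetilde a(\omega\cdot t)|_{t=0}$. A map $a:\Omega\to X$ such that $y_t(\omega,a(\omega))$ exists for all $t\ge0$ and $\omega\in\Omega$ is a sub-equilibrium for the exponential ordering if $a(\omega\cdot t)\le_B y_t(\omega,a(\omega))$ for each $\omega\in\Omega$ and $t\ge0$. It is strong if in addition there is a time $s_*>0$ such that $a(\omega\cdot s_* )\ll_B y_{s_*}(\omega,a(\omega))$ for each $\omega\in\Omega$. *)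

(* Defs.v *)
From HB Require Import structures.
From mathcomp Require Import all_boot all_order all_algebra.
From mathcomp Require Import all_classical all_reals all_analysis.

Set Implicit Arguments.
Unset Strict Implicit.
Unset Printing Implicit Defensive.

Import Order.TTheory GRing.Theory Num.Theory.
Import numFieldNormedType.Exports.

Local Open Scope classical_set_scope.
Local Open Scope ring_scope.

(* C([-r,0], V) with the sup norm. A continuous function on [-r,0] is
   represented by its extension by 0 to the whole line, so that Leibniz
   equality is equality of functions on [-r,0]. *)
Section ContinuousSegment.
Context (R : realType) (r : R) (V : normedModType R).

Definition cseg_pred : {pred R -> V} := mem [set f : R -> V |
  {within `[- r, 0], continuous f} /\ forall s, s \notin `[- r, 0] -> f s = 0].

Record cseg := Cseg { cseg_fun :> R -> V ; _ : cseg_fun \in cseg_pred }.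

HB.instance Definition _ := [isSub for cseg_fun].
HB.instance Definition _ := [Choice of cseg by <:].

Lemma cseg_within (f : cseg) : {within `[- r, 0], continuous f}.
Proof. by have := valP f; rewrite inE => -[]. Qed.

Lemma cseg_out (f : cseg) s : s \notin `[- r, 0] -> f s = 0.
Proof. by have := valP f; rewrite inE => -[_]; exact. Qed.

Lemma cseg_submod_closed : submod_closed cseg_pred.
Proof.
split => [|a f g].
  by rewrite inE; split => // x; exact: cvg_cst.
rewrite !inE => -[fc f0] [gc g0]; split => [x|s sN].
  exact: (cvgD (cvgZl_tmp (k := a) (fc x)) (gc x)).
have -> : (a *: f + g) s = a *: f s + g s by [].
by rewrite f0// g0// scaler0 addr0.
Qed.

HB.instance Definition _ :=
  GRing.isSubmodClosed.Build _ _ cseg_pred cseg_submod_closed.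
HB.instance Definition _ := [SubChoice_isSubLmodule of cseg by <:].

Lemma csegP (f g : cseg) : {in `[- r, 0], f =1 g} -> f = g.
Proof.
move=> fg; apply/val_inj/funext => s /=.
by have [/fg//|sN] := boolP (s \in `[- r, 0]); rewrite !cseg_out.
Qed.

Definition cseg_norm (f : cseg) : R := sup [set `|f s| | s in `[- r, 0]].

Lemma cseg_has_ubound (f : cseg) : has_ubound [set `|f s| | s in `[- r, 0]].
Proof.
have : compact (f @` `[- r, 0]).
  by apply: continuous_compact; [exact: cseg_within|exact: segment_compact].
move=> /compact_bounded[M [_ fM]]; exists (M + 1) => _ [s sr <-].
by apply: (fM (M + 1)); [rewrite ltrDl|exists s].
Qed.

Lemma cseg_norm_ge (f : cseg) s : s \in `[- r, 0] -> `|f s| <= cseg_norm f.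
Proof.
by move=> sr; apply: ub_le_sup; [exact: cseg_has_ubound|exists s].
Qed.

Lemma cseg_norm_le (f : cseg) (c : R) : 0 <= c ->
  (forall s, s \in `[- r, 0] -> `|f s| <= c) -> cseg_norm f <= c.
Proof.
move=> c0 fc; rewrite /cseg_norm.
have [->|ne] := eqVneq [set `|f s| | s in `[- r, 0]] set0; first by rewrite sup0.
by apply: ge_sup; [exact/set0P|move=> _ [s sr <-]; exact: fc].
Qed.

Lemma cseg_norm_ge0 (f : cseg) : 0 <= cseg_norm f.
Proof.
rewrite /cseg_norm.
have [->|/set0P[x [s sr _]]] := eqVneq [set `|f s| | s in `[- r, 0]] set0.
  by rewrite sup0.
exact: le_trans (normr_ge0 _) (cseg_norm_ge f sr).
Qed.

Lemma cseg_normD (f g : cseg) : cseg_norm (f + g) <= cseg_norm f + cseg_norm g.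
Proof.
apply: cseg_norm_le => [|s sr]; first by rewrite addr_ge0 ?cseg_norm_ge0.
have -> : (f + g) s = f s + g s by [].
by apply: le_trans (ler_normD _ _) _; rewrite lerD ?cseg_norm_ge.
Qed.

Lemma cseg_normZ (a : R) (f : cseg) : cseg_norm (a *: f) = `|a| * cseg_norm f.
Proof.
have le b g : cseg_norm (b *: g) <= `|b| * cseg_norm g.
  apply: cseg_norm_le => [|s sr]; first by rewrite mulr_ge0 ?cseg_norm_ge0.
  have -> : (b *: g) s = b *: g s by [].
  by rewrite normrZ ler_wpM2l ?cseg_norm_ge.
apply/eqP; rewrite eq_le le/=.
have [->|a0] := eqVneq a 0; first by rewrite normr0 mul0r cseg_norm_ge0.
have /= := le a^-1 (a *: f); rewrite scalerA mulVf// scale1r normfV.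
by rewrite ler_pdivlMl ?normr_gt0.
Qed.

Lemma cseg_norm_eq0 (f : cseg) : cseg_norm f = 0 -> f = 0.
Proof.
move=> f0; apply: csegP => s sr; apply/eqP.
by rewrite -normr_le0 -f0 cseg_norm_ge.
Qed.

HB.instance Definition _ :=
  Lmodule_isNormed.Build R cseg cseg_normD cseg_normZ cseg_norm_eq0.

(* The restriction of f to [-r,0]; the value is 0 (and never used below)
   if f is not continuous on [-r,0]. *)
Definition cseg_of (f : R -> V) : cseg :=
  insubd 0 (fun s => if s \in `[- r, 0] then f s else 0).

Lemma cseg_ofE (f : R -> V) : {within `[- r, 0], continuous f} ->
  {in `[- r, 0], cseg_of f =1 f}.
Proof.
move=> fc s sr; rewrite /cseg_of -[LHS]/(val _ s) val_insubd ifT ?sr//.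
rewrite inE; split => [|u /negbTE->//].
apply: (subspace_eq_continuous _ fc) => u; rewrite inE => ur.
by rewrite /from_subspace ifT.
Qed.

End ContinuousSegment.

Section Ordering.
Context (R : realType) (m : nat).
Implicit Types (x y : 'cV[R]_m) (B : 'M[R]_m).

(* x <= y and x << y in R^m *)
Definition vle x y := forall i, x i 0 <= y i 0.
Definition vlt x y := forall i, x i 0 < y i 0.

Definition quasipositive B := forall i j, i != j -> 0 <= B i j.

Definition expmx B : 'M[R]_m :=
  limn (series (fun k : nat => (k`!%:R)^-1 *: B ^+ k)).

End Ordering.

Section ExponentialOrdering.
Context (R : realType) (m : nat) (r : R) (B : 'M[R]_m).
Local Notation X := (cseg r 'cV[R]_m).
Implicit Types (phi psi : X).

(* phi << psi in X *)
Definition cseg_lt phi psi := forall s, s \in `[- r, 0] -> vlt (phi s) (psi s).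

Definition KB : set X := [set phi |
  (forall s, s \in `[- r, 0] -> vle 0 (phi s)) /\
  (forall s t, - r <= s -> s <= t -> t <= 0 ->
     vle (expmx ((t - s) *: B) *m phi s) (phi t))].

Definition leB phi psi := KB (psi - phi).

(* X_L and its norm *)
Definition XL : set X := [set phi | [lipschitz phi s | s in `[- r, 0]]].

Definition lip_const phi : R :=
  sup [set q | exists s t, [/\ s \in `[- r, 0], t \in `[- r, 0], s != t &
                              q = `|phi t - phi s| / `|t - s|]].

Definition XL_norm phi : R := `|phi| + lip_const phi.

(* Interior, for the norm of X_L, of the trace of K_B on X_L *)
Definition IntKB : set X := [set phi | XL phi /\
  exists2 e : R, 0 < e &
    forall psi, XL psi -> XL_norm (psi - phi) < e -> KB psi].

Definition ltB phi psi := IntKB (psi - phi).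

End ExponentialOrdering.

Section Flow.
Context (R : realType) (Omega : metricType R) (sigma : R -> Omega -> Omega).

Definition continuous_flow :=
  [/\ continuous (fun p : R * Omega => sigma p.1 p.2),
      (forall w, sigma 0 w = w) &
      (forall t s w, sigma (t + s) w = sigma t (sigma s w))].

Definition minimal_flow := forall K : set Omega,
  closed K -> K !=set0 -> (forall t, sigma t @` K = K) -> K = setT.

Context (m : nat).

Definition C1_along (ta : Omega -> 'cV[R]_m) := forall w,
  (forall t, derivable (fun u : R => ta (sigma u w)) t 1) /\
  continuous (derive1 (fun u : R => ta (sigma u w))).

Definition deriv_along (ta : Omega -> 'cV[R]_m) (w : Omega) : 'cV[R]_m :=
  derive1 (fun u : R => ta (sigma u w)) 0.

Context (r : R).
Local Notation X := (cseg r 'cV[R]_m).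

(* a(w)(s) = ta(w.s), -r <= s <= 0 *)
Definition hist (ta : Omega -> 'cV[R]_m) (w : Omega) : X :=
  cseg_of r (fun s => ta (sigma s w)).

(* y_t *)
Definition segment_at (y : R -> 'cV[R]_m) (t : R) : X :=
  cseg_of r (fun s => y (t + s)).

Context (F : Omega -> X -> 'cV[R]_m).

(* F is C^1 in its second variable: the derivative exists everywhere and is
   continuous from Omega x X to L(X, R^m) with the operator norm. *)
Definition C1_snd :=
  (forall w phi, differentiable (F w) phi) /\
  (forall w0 phi0 (e : R), 0 < e -> \forall w \near w0 & phi \near phi0,
     forall h : X, `|'d (F w) phi h - 'd (F w0) phi0 h| <= e * `|h|).

(* y is a solution on [-r,+oo[ of y'(t) = F(w.t, y_t), y_0 = phi. The
   derivative is taken relative to [0,+oo[, i.e. it is one-sided at t = 0. *)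
Definition global_solution (w : Omega) (phi : X) (y : R -> 'cV[R]_m) :=
  [/\ {within `[- r, +oo[, continuous y},
      {in `[- r, 0], y =1 phi} &
      forall t, 0 <= t ->
        h^-1 *: (y (t + h) - y t) @[h --> within [set h | 0 <= t + h] 0^']
          --> F (sigma t w) (segment_at y t)].

(* y_t(w, a(w)) exists for all t >= 0 and all w *)
Definition globally_defined (a : Omega -> X) :=
  forall w, exists y, global_solution w (a w) y.

Context (B : 'M[R]_m).

Definition sub_equilibrium (a : Omega -> X) := globally_defined a /\
  forall w y, global_solution w (a w) y ->
    forall t, 0 <= t -> leB B (a (sigma t w)) (segment_at y t).

Definition strong_sub_equilibrium (a : Omega -> X) := sub_equilibrium a /\
  exists2 s : R, 0 < s &
    forall w y, global_solution w (a w) y ->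
      ltB B (a (sigma s w)) (segment_at y s).

End Flow.

(* Main.v *)
(* Along an orbit, put x(t) = ta(w.t) and let y be the solution issued from
   a(w). To see that z = y - x stays in K_B, solve v' = B v + (z' - B z)^+ with
   v = z in the past. Both v and d = v - z lie in K_B, so monotonicity of F
   between x and x + v = y + d gives d' <= C |d_t|, and d = 0 by Gronwall's
   lemma; this replaces the usual approximation by strict inequalities and
   needs no existence theorem for delay equations. For (ii), positivity of
   exp(tB) propagates a strict inequality at w0 to every t > 0, hence, by
   continuous dependence at one fixed time s, to all w near w0. By minimality
   every forward orbit visits this neighbourhood before some uniform time T;
   from T + s on z is >> 0, after a further delay r so is z' - B z, and after
   another r the segment of z is interior to K_B. *)
Require Import Defs.
From mathcomp Require Import all_boot all_order all_algebra.
From mathcomp Require Import all_classical all_reals all_analysis.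
From mathcomp Require Import ring lra.

Set Implicit Arguments.
Unset Strict Implicit.
Unset Printing Implicit Defensive.

Import Order.TTheory GRing.Theory Num.Theory.
Import numFieldNormedType.Exports.

Local Open Scope classical_set_scope.
Local Open Scope ring_scope.


(** * Matrix-valued functions *)

Section MatrixNorm.
Context {R : realType} {p q : nat}.
Implicit Types M N : 'M[R]_(p, q).

(** Monotonicity of [F] says something only about pairs already ordered by the cone, so applying it
    to x and y at the outset would be circular: that order is the claim. The function v breaks the
    circle. Its forcing is nonnegative by construction, so x and x + v are ordered whatever y does;
    and since y is given, its equation is linear and without delay, hence solved by variation of
    constants. The map [a] is continuous only where this is assumed, so continuous dependence can
    start only at w0 and be read off only at the time s. What it yields is the positivity of a
    single vector, and everything stronger must be gained by propagation along orbits. Finally,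
    [IntKB] is an interior for a norm, so membership is proved by perturbation: over a pair of times
    s <= s', the gain from a lower bound on z' - B z and the loss due to a Lipschitz perturbation
    are both proportional to s' - s, and this makes them comparable. *)

Lemma subr_mxE M N i j : (M - N) i j = M i j - N i j.
Proof. by rewrite !mxE. Qed.

Lemma ler_norm_entry M i j : `|M i j| <= `|M|.
Proof.
rewrite [leRHS]/Num.Def.normr/= mx_normrE.
exact: (le_bigmax _ (fun ij : 'I_p * 'I_q => `|M ij.1 ij.2|) (i, j)).
Qed.

Lemma ler_mx_norm M c : 0 <= c -> (forall i j, `|M i j| <= c) -> `|M| <= c.
Proof.
by move=> c0 Mc; rewrite [leLHS]/Num.Def.normr/= mx_normrE bigmax_le.
Qed.

Lemma cvg_mxP {T : Type} {F : set_system T} {FF : Filter F}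
    (f : T -> 'M[R]_(p, q)) (l : 'M[R]_(p, q)) :
  f x @[x --> F] --> l <-> forall i j, f x i j @[x --> F] --> l i j.
Proof.
split=> [fl i j|fl].
  apply/cvgrPdist_le => e e0; move/cvgrPdist_le : fl => /(_ _ e0).
  apply: filterS => x; apply: le_trans.
  by have := ler_norm_entry (l - f x) i j; rewrite !mxE.
apply/cvgrPdist_le => e e0; near=> x.
apply: ler_mx_norm (ltW e0) _ => i j; rewrite !mxE; move: i j; near: x.
apply: filter_forall => i; apply: filter_forall => j.
exact: ((cvgrPdist_le _ _).1 (fl i j)).
Unshelve. all: by end_near. Qed.

Lemma is_derive_mxP (f : R -> 'M[R]_(p, q)) (t : R) l :
  is_derive t (1 : R) f l <->
  forall i j, is_derive t (1 : R) (fun s => f s i j) (l i j).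
Proof.
split=> [[df fl] i j|fl].
  have dfij : derivable (fun s => f s i j) t (1 : R).
    exact: (derivable_mxP _ _ _).1.
  by split=> //; rewrite -fl derive_mx// mxE.
have df : derivable f t (1 : R).
  by apply/derivable_mxP => i j; have [] := fl i j.
by split=> //; rewrite derive_mx//; apply/matrixP => i j; rewrite mxE derive_val.
Qed.

End MatrixNorm.

Section MatrixProduct.
Context {R : realType} {p q n : nat}.

Lemma cvg_mulmx {T : Type} {F : set_system T} {FF : Filter F}
    (f : T -> 'M[R]_(p, q)) (g : T -> 'M[R]_(q, n))
    (a : 'M[R]_(p, q)) (b : 'M[R]_(q, n)) :
  f x @[x --> F] --> a -> g x @[x --> F] --> b ->
  f x *m g x @[x --> F] --> a *m b.
Proof.
move=> /cvg_mxP fa /cvg_mxP gb; apply/cvg_mxP => i j.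
rewrite mxE; under eq_fun do rewrite mxE.
apply: (@cvg_big _ _ +%R 0 _ add_continuous) => k _.
by apply: cvgM; [exact: fa|exact: gb].
Qed.

Lemma is_derive_mulmx (f : R -> 'M[R]_(p, q)) (g : R -> 'M[R]_(q, n)) (t : R) a b :
  is_derive t (1 : R) f a -> is_derive t (1 : R) g b ->
  is_derive t (1 : R) (fun s => f s *m g s) (a *m g t + f t *m b).
Proof.
move=> /is_derive_mxP fa /is_derive_mxP gb; apply/is_derive_mxP => i j.
have -> : (fun s => (f s *m g s) i j) =
    \sum_(k < q) (fun s => f s i k * g s k j).
  by apply/funext => s; rewrite mxE fct_sumE.
have -> : (a *m g t + f t *m b) i j =
    \sum_(k < q) (f t i k *: b k j + g t k j *: a i k).
  rewrite !mxE -big_split/=; apply: eq_bigr => k _.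
  by rewrite addrC; congr (_ + _); exact: mulrC.
apply: is_derive_sum => k.
exact: (is_deriveM (fa i k) (gb k j)).
Qed.

(** The norm is the largest absolute value of an entry, which is not submultiplicative; hence the
    factor [q]. *)
Lemma ler_norm_mulmx (A : 'M[R]_(p, q)) (u : 'M[R]_(q, n)) :
  `|A *m u| <= q%:R * `|A| * `|u|.
Proof.
apply: ler_mx_norm => [|i j]; first by rewrite !mulr_ge0.
rewrite mxE (le_trans (ler_norm_sum _ _ _))//.
apply: (@le_trans _ _ (\sum_(k < q) `|A| * `|u|)).
  by apply: ler_sum => k _; rewrite normrM ler_pM// ler_norm_entry.
by rewrite sumr_const card_ord -mulrA mulr_natl.
Qed.

End MatrixProduct.

Lemma continuous_maxr_cst {R : realType} (a : R) :
  continuous (fun x : R => Num.max x a : R).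
Proof.
by move=> x; apply: (@continuous_max R R id (cst a) x);
  [exact: cvg_id|exact: cvg_cst].
Qed.

Lemma continuous_minr_cst {R : realType} (a : R) :
  continuous (fun x : R => Num.min x a : R).
Proof.
by move=> x; apply: (@continuous_min R R id (cst a) x);
  [exact: cvg_id|exact: cvg_cst].
Qed.

(** * The exponential of a matrix *)

Section MatrixExponential.
Context {R : realType} {m : nat}.
Implicit Types A B C : 'M[R]_m.

Lemma ler_norm_expr B k : `|B ^+ k| <= (m%:R * `|B|) ^+ k.
Proof.
elim: k => [|k IH].
  rewrite expr0; apply: ler_mx_norm => // i j; rewrite mxE.
  by case: (i == j); rewrite ?normr1// normr0.
rewrite exprS (le_trans (ler_norm_mulmx _ _))// exprS.
by rewrite ler_wpM2l// mulr_ge0.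
Qed.

(** Power series coefficients of an entry of C exp(tB). The left factor [C] makes the family closed
    under termwise differentiation, which replaces [C] by [C *m B]. *)
Definition expmx_coef C B i j (k : nat) : R := (C *m B ^+ k) i j / k`!%:R.

Lemma pseries_diffs_expmx_coef C B i j :
  pseries_diffs (expmx_coef C B i j) = expmx_coef (C *m B) B i j.
Proof.
apply/funext => k; rewrite /pseries_diffs /expmx_coef exprS mulmxA factS natrM.
by rewrite invfM mulrCA mulVKf// pnatr_eq0.
Qed.

Lemma is_cvg_expmx_coef C B i j x : cvgn (pseries (expmx_coef C B i j) x).
Proof.
apply: normed_cvg.
apply: (@series_le_cvg _ _
  (fun k => m%:R * `|C| * exp_coeff (m%:R * `|B| * `|x|) k)) => //.
- by move=> k /=; exact: normr_ge0.
- by move=> k; rewrite mulr_ge0 ?mulr_ge0// exp_coeff_ge0 ?mulr_ge0.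
- move=> k /=; rewrite normrM normrX /expmx_coef normrM /exp_coeff/=.
  rewrite normfV normr_nat mulrAC exprMn !mulrA ler_wpM2r ?invr_ge0//.
  rewrite ler_wpM2r ?exprn_ge0// (le_trans (ler_norm_entry _ _ _))//.
  rewrite (le_trans (ler_norm_mulmx _ _))// ler_wpM2l ?mulr_ge0//.
  exact: ler_norm_expr.
- exact/is_cvg_seriesZ/is_cvg_series_exp_coeff.
Qed.

Lemma cvg_expmx B : series (fun k : nat => (k`!%:R)^-1 *: B ^+ k) @ \oo
  --> (\matrix_(i, j) limn (pseries (expmx_coef 1%:M B i j) 1) : 'M[R]_m).
Proof.
apply/cvg_mxP => i j; rewrite mxE.
have -> : (fun n => series (fun k : nat => (k`!%:R)^-1 *: B ^+ k) n i j) =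
    pseries (expmx_coef 1%:M B i j) 1.
  apply/funext => n; rewrite /pseries /series/= summxE; apply: eq_bigr => k _.
  by rewrite mxE /expmx_coef mul1mx expr1n mulr1 mulrC.
exact: is_cvg_expmx_coef.
Qed.

Lemma expmxE B i j : expmx B i j = limn (pseries (expmx_coef 1%:M B i j) 1).
Proof.
by rewrite /expmx (cvg_lim (@norm_hausdorff _ _) (@cvg_expmx B)) mxE.
Qed.

Lemma expmxZE B (t : R) i j :
  expmx (t *: B) i j = limn (pseries (expmx_coef 1%:M B i j) t).
Proof.
rewrite expmxE; congr (lim (_ @ \oo)); apply/funext => n.
rewrite /pseries /series/=; apply: eq_bigr => k _.
rewrite /expmx_coef !mul1mx expr1n mulr1.
have -> : (t *: B) ^+ k = t ^+ k *: B ^+ k.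
  elim: k => [|k IH]; first by rewrite !expr0 scale1r.
  rewrite !exprS IH -[LHS]/((t *: B) *m (t ^+ k *: B ^+ k)).
  by rewrite -scalemxAl -scalemxAr scalerA.
by rewrite mxE -mulrA mulrC.
Qed.

Lemma mulmx_expmxZE C B (t : R) i j :
  (C *m expmx (t *: B)) i j = limn (pseries (expmx_coef C B i j) t).
Proof.
apply/esym/cvg_lim => //; rewrite mxE.
have -> : pseries (expmx_coef C B i j) t = (fun n => \sum_(k < m) C i k *
    pseries (expmx_coef 1%:M B k j) t n).
  apply/funext => n; rewrite /pseries /series/=.
  under [RHS]eq_bigr do rewrite mulr_sumr.
  rewrite exchange_big/=; apply: eq_bigr => l _.
  rewrite /expmx_coef mul1mx mxE !mulr_suml; apply: eq_bigr => k _.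
  by rewrite !mulrA.
apply: (@cvg_big _ _ +%R 0 _ add_continuous) => k _.
by rewrite expmxZE; apply: cvgMr; exact: is_cvg_expmx_coef.
Qed.

Lemma mulmx_expmxC B (t : R) : expmx (t *: B) *m B = B *m expmx (t *: B).
Proof.
apply/matrixP => i j; rewrite [RHS]mulmx_expmxZE; apply/esym/cvg_lim => //.
rewrite mxE.
have -> : pseries (expmx_coef B B i j) t = (fun n => \sum_(k < m)
    pseries (expmx_coef 1%:M B i k) t n * B k j).
  apply/funext => n; rewrite /pseries /series/=.
  under [RHS]eq_bigr do rewrite mulr_suml.
  rewrite exchange_big/=; apply: eq_bigr => l _.
  have -> : expmx_coef B B i j l = (B ^+ l *m B) i j / l`!%:R.
    by rewrite /expmx_coef -[B *m _]exprS -[_ *m B]exprSr.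
  rewrite mxE !mulr_suml; apply: eq_bigr => k _.
  by rewrite /expmx_coef mul1mx; ring.
apply: (@cvg_big _ _ +%R 0 _ add_continuous) => k _.
by rewrite expmxZE; apply: cvgMl; exact: is_cvg_expmx_coef.
Qed.

Lemma is_derive_expmx B (t : R) :
  is_derive t (1 : R) (fun s => expmx (s *: B)) (B *m expmx (t *: B)).
Proof.
apply/is_derive_mxP => i j; rewrite mulmx_expmxZE -[B in expmx_coef B]mul1mx.
rewrite -pseries_diffs_expmx_coef; under eq_fun do rewrite expmxZE.
apply: (@pseries_snd_diffs _ _ (`|t| + 1));
  rewrite ?pseries_diffs_expmx_coef; try exact: is_cvg_expmx_coef.
by rewrite [ltRHS]ger0_norm ?addr_ge0// ltrDl.
Qed.

Lemma expmx0 : expmx 0 = 1%:M :> 'M[R]_m.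
Proof.
rewrite -(scale0r (0 : 'M[R]_m)); apply/matrixP => i j.
(* The partial sum of length 0 is empty, so the partial sums are constant only from length 1 on;
   hence the shift. *)
rewrite expmxZE; apply: cvg_lim => //; rewrite -cvg_shiftS.
apply: cvg_near_cst; apply: nearW => n.
rewrite /pseries /series/= big_nat_recl//= big1 => [|k _].
  by rewrite /expmx_coef mul1mx !expr0 mulr1 fact0 divr1 addr0.
by rewrite expr0n/= mulr0.
Qed.

Lemma is_derive_expmx_sub B (t u : R) :
  is_derive u (1 : R) (fun v => expmx ((t - v) *: B))
    (- (B *m expmx ((t - u) *: B))).
Proof.
apply/is_derive_mxP => k l.
have := (is_derive_mxP _ _ _).1 (is_derive_expmx B (t - u)) k l.
have dg : is_derive u (1 : R) (fun v => t - v) (-1).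
  by apply: is_derive_eq; rewrite add0r ?mul1r.
move=> df; have dc := @is_derive1_comp R (fun w => expmx (w *: B) k l)
    (fun v => t - v) u _ _ df dg.
by apply: (is_derive_eq dc); rewrite mulrN1 [RHS]mxE.
Qed.

(* The right-hand side, with [s] replaced by [u] and [t] by [t + s - u], does
   not depend on [u]. For c = 0 this is the semigroup property; for c = |B|, it
   reduces positivity to the case of the nonnegative matrix B + c. *)
Lemma expmxD_scalar B (c t s : R) :
  expmx ((t + s) *: B) =
  expR (- (c * s)) *: (expmx (t *: B) *m expmx (s *: (B + c%:M))).
Proof.
pose D := B + c%:M.
pose f u := expR (- (c * u)) *: (expmx ((t + s - u) *: B) *m expmx (u *: D)).
suff : f 0 = f s.
  rewrite /f addrK subr0 mulr0 oppr0 expR0 scale1r scale0r expmx0 mulmx1.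
  by [].
apply/matrixP => i j; apply: (@is_derive_0_is_cst _ (fun u => f u i j)) => u.
have := is_derive_mulmx (is_derive_expmx_sub B (t + s) u) (is_derive_expmx D u).
move=> /is_derive_mxP /(_ i j) dp.
have dx : is_derive u (1 : R) (fun v => expR (- (c * v)))
    (- c * expR (- (c * u))).
  have dg : is_derive u (1 : R) (fun v => - (c * v)) (- c).
    by apply: is_derive_eq; rewrite [_ *: _]mulr1.
  have := @is_derive1_comp R expR (fun v => - (c * v)) u _ _
    (is_derive_expR _) dg.
  by rewrite mulrC; exact.
have -> : (fun v => f v i j) = (fun v => expR (- (c * v))) *
    (fun v => (expmx ((t + s - v) *: B) *m expmx (v *: D)) i j).
  by apply/funext => v; rewrite /f mxE.
apply: (is_derive_eq (is_deriveM dx dp)).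
set E := expmx ((t + s - u) *: B); set E' := expmx (u *: D).
have -> : - (B *m E) *m E' + E *m (D *m E') = c *: (E *m E').
  have : E *m B = B *m E by exact: mulmx_expmxC.
  rewrite /D; move: E E' => {}E {}E' BE.
  by rewrite mulNmx mulmxA mulmxDr mulmxDl BE addKr mul_mx_scalar scalemxAl.
rewrite mxE; set x := expR _; set y := (E *m E') i j.
by rewrite -[_ *: _]/(_ * _) -[y *: _]/(y * _); ring.
Qed.

Lemma expmxD B (t s : R) :
  expmx ((t + s) *: B) = expmx (t *: B) *m expmx (s *: B).
Proof.
have := expmxD_scalar B 0 t s; rewrite mul0r oppr0 expR0 scale1r.
by rewrite raddf0 addr0.
Qed.

(** For a nonnegative matrix every term of the series is nonnegative, so a partial sum is at least
    its term of index 0, the identity. *)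
Lemma expmx_ge1 B (t : R) i j : 0 <= t -> (forall k l, 0 <= B k l) ->
  (1%:M : 'M[R]_m) i j <= expmx (t *: B) i j.
Proof.
move=> t0 B0; rewrite expmxZE.
apply: limr_ge; first exact: is_cvg_expmx_coef.
near=> n; rewrite /pseries /series/=.
rewrite -(@subnK 1 n) ?addn1; last by near: n; exact: nbhs_infty_ge.
rewrite big_nat_recl// /expmx_coef !mul1mx expr0 fact0 divr1 expr0 mulr1 lerDl.
apply: sumr_ge0 => k _; rewrite mul1mx !mulr_ge0// ?exprn_ge0 ?invr_ge0//.
move: i j; elim: k.+1 => [|{}k IH] i j; first by rewrite expr0 mxE.
by rewrite exprS mxE; apply: sumr_ge0 => l _; rewrite mulr_ge0.
Unshelve. all: by end_near. Qed.

(** Adding [|B|] on the diagonal makes a quasipositive matrix nonnegative, at the cost of a scalar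
    factor. The bound keeps a positive diagonal because plain nonnegativity would not carry strict
    inequalities or uniform margins through exp(tB). *)
Lemma expmx_ge B (t : R) i j : quasipositive B -> 0 <= t ->
  expR (- (`|B| * t)) * (1%:M : 'M[R]_m) i j <= expmx (t *: B) i j.
Proof.
move=> qB t0; rewrite -[t in leRHS]add0r (expmxD_scalar B `|B|).
rewrite scale0r expmx0 mul1mx [leRHS]mxE ler_wpM2l ?expR_ge0// expmx_ge1// => k l.
rewrite !mxE; have [->|kl] := eqVneq k l; last by rewrite mulr0n addr0 qB.
have := ler_norm_entry B l l; rewrite ler_norml mulr1n => /andP[+ _].
by rewrite -lerBlDr sub0r.
Qed.

Lemma expmx_ge0 B (t : R) i j : quasipositive B -> 0 <= t ->
  0 <= expmx (t *: B) i j.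
Proof.
move=> qB t0; apply: le_trans (expmx_ge i j qB t0).
by rewrite mulr_ge0 ?expR_ge0// mxE ler0n.
Qed.

Lemma continuous_expmx B : continuous (fun t : R => expmx (t *: B)).
Proof.
move=> t; apply/cvg_mxP => i j.
have := (is_derive_mxP _ _ _).1 (is_derive_expmx B t) i j => -[+ _].
by move=> /derivable1_diffP /differentiable_continuous.
Qed.

Lemma cvg_expmx_comp B {T : Type} {F : set_system T} {FF : Filter F}
    (f : T -> R) (l : R) :
  f x @[x --> F] --> l -> expmx (f x *: B) @[x --> F] --> expmx (l *: B).
Proof.
move=> fl.
exact: (@cvg_comp _ _ _ f (fun t => expmx (t *: B)) _ _ _ fl
  (@continuous_expmx B l)).
Qed.

Lemma vle_mulmx_expmx B (t : R) (x y : 'cV[R]_m) : quasipositive B -> 0 <= t ->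
  vle x y -> vle (expmx (t *: B) *m x) (expmx (t *: B) *m y).
Proof.
move=> qB t0 xy i; rewrite !mxE; apply: ler_sum => k _.
by rewrite ler_wpM2l// expmx_ge0.
Qed.

Lemma mulmx_expmx_ge B (t e : R) (x : 'cV[R]_m) i : quasipositive B -> 0 <= t ->
  0 <= e -> (forall k, e <= x k 0) ->
  expR (- (`|B| * t)) * e <= (expmx (t *: B) *m x) i 0.
Proof.
move=> qB t0 e0 xe; rewrite mxE (bigD1 i)//=.
apply: (@le_trans _ _ (expmx (t *: B) i i * x i 0)); last first.
  rewrite lerDl; apply: sumr_ge0 => k _.
  by rewrite mulr_ge0 ?expmx_ge0// (le_trans e0).
rewrite ler_pM ?expR_ge0//.
by have := expmx_ge i i qB t0; rewrite mxE eqxx mulr1.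
Qed.

End MatrixExponential.

(** * Linear differential inequalities and equations *)

Section LinearInequality.
Context {R : realType} {m : nat} (B : 'M[R]_m).
Implicit Types (u du : R -> 'cV[R]_m).

(** Mean value theorem for x -> exp((t - x)B) u(x), whose derivative is exp((t - x)B)(u' - B u)
    because B commutes with its exponential. It stands in for the variation-of-constants integral;
    the intermediate point depends on the coordinate [i]. *)
Lemma expmx_MVT u du (s t : R) i : s < t -> continuous u ->
  (forall x, s < x -> x < t -> is_derive x (1 : R) u (du x)) ->
  exists x, [/\ s < x, x < t & u t i 0 - (expmx ((t - s) *: B) *m u s) i 0 =
    (expmx ((t - x) *: B) *m (du x - B *m u x)) i 0 * (t - s)].
Proof.
move=> st uc udu; pose v x := (expmx ((t - x) *: B) *m u x) i 0.
pose dv x := (expmx ((t - x) *: B) *m (du x - B *m u x)) i 0.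
have vdv x : x \in `]s, t[ -> is_derive x (1 : R) v (dv x).
  rewrite in_itv/= => /andP[sx xt].
  have := is_derive_mulmx (is_derive_expmx_sub B t x) (udu x sx xt).
  move=> /is_derive_mxP /(_ i 0) dp; apply: (is_derive_eq dp).
  by rewrite /dv -mulmx_expmxC mulmxBr mulNmx mulmxA addrC.
have vc : {within `[s, t], continuous v}.
  apply: continuous_subspaceT => x.
  apply: (cvg_mxP _ _).1; apply: cvg_mulmx (uc x).
  by apply: cvg_expmx_comp; apply: cvgB; [exact: cvg_cst|exact: cvg_id].
have [x] := MVT st vdv vc; rewrite in_itv/= => /andP[sx xt].
rewrite /v subrr scale0r expmx0 mul1mx => eq.
by exists x.
Qed.

Hypothesis qB : quasipositive B.

Lemma expmx_MVT_ge u du (s t e : R) i : s <= t -> 0 <= e -> continuous u ->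
  (forall x, s < x -> x < t -> is_derive x (1 : R) u (du x)) ->
  (forall x, s < x -> x < t -> forall k, e <= (du x - B *m u x) k 0) ->
  expR (- (`|B| * (t - s))) * e * (t - s) <=
  u t i 0 - (expmx ((t - s) *: B) *m u s) i 0.
Proof.
rewrite le_eqVlt => /predU1P[-> _ _ _ _|st e0 uc udu ue].
  by rewrite subrr scale0r expmx0 mul1mx !subrr mulr0.
have [x [sx xt ->]] := expmx_MVT i st uc udu.
rewrite ler_wpM2r ?subr_ge0 ?(ltW st)//.
apply: le_trans (mulmx_expmx_ge _ qB _ e0 (ue x sx xt)); last first.
  by rewrite subr_ge0 ltW.
(* The intermediate time is unknown, so the exponential factor is replaced by its worst value, that
   of the full length [t - s]. *)
by rewrite ler_wpM2r// ler_expR lerN2 ler_wpM2l// lerD2l lerN2 ltW.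
Qed.

Lemma expmx_le u du (s t : R) : s <= t -> continuous u ->
  (forall x, s < x -> x < t -> is_derive x (1 : R) u (du x)) ->
  (forall x, s < x -> x < t -> vle (B *m u x) (du x)) ->
  vle (expmx ((t - s) *: B) *m u s) (u t).
Proof.
move=> st uc udu ue i.
have := @expmx_MVT_ge u du s t 0 i st (lexx _) uc udu.
rewrite mulr0 mul0r subr_ge0; apply => x sx xt k.
by rewrite subr_mxE subr_ge0 ue.
Qed.

Lemma mulmx_expmx_gt0 (t : R) (x : 'cV[R]_m) : 0 <= t -> vlt 0 x ->
  vlt 0 (expmx (t *: B) *m x).
Proof.
move=> t0 x0 i; rewrite [ltLHS]mxE mxE (bigD1 i)//=.
have x0' k : 0 < x k 0 by have := x0 k; rewrite mxE.
rewrite ltr_wpDr//.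
  by apply: sumr_ge0 => k _; rewrite mulr_ge0 ?expmx_ge0// ltW.
rewrite mulr_gt0//; apply: lt_le_trans (expmx_ge i i qB t0).
by rewrite mxE eqxx mulr1 expR_gt0.
Qed.

Lemma expmx_lt u du (s t : R) : s < t -> continuous u ->
  (forall x, s < x -> x < t -> is_derive x (1 : R) u (du x)) ->
  (forall x, s < x -> x < t -> vlt (B *m u x) (du x)) ->
  vlt (expmx ((t - s) *: B) *m u s) (u t).
Proof.
move=> st uc udu ue i; rewrite -subr_gt0.
have [x [sx xt ->]] := expmx_MVT i st uc udu.
rewrite mulr_gt0 ?subr_gt0//.
have tx : 0 <= t - x by rewrite subr_ge0 ltW.
have := @mulmx_expmx_gt0 (t - x) (du x - B *m u x) tx.
move=> /(_ _ i); rewrite [X in X < _]mxE; apply => k.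
by rewrite mxE subr_mxE subr_gt0 ue.
Qed.

End LinearInequality.

Section LinearEquation.
Context {R : realType}.

Lemma antiderivative (f : R -> R) : continuous f ->
  exists F : R -> R, [/\ continuous F, F 0 = 0 &
    forall x : R, 0 < x -> is_derive x (1 : R) F (f x)].
Proof.
move=> fc; pose mu := @lebesgue_measure R.
(* Starting the integral at -1 makes 0 an interior point, so that [G] is continuous there too;
   composing with [max x 0] then never leaves the domain where [G] is known to be differentiable. *)
pose G x : R := (\int[mu]_(t in `[(-1 : R), x]) f t)%R.
have Gd (x : R) : -1 < x -> is_derive x (1 : R) G (f x).
  move=> x1.
  have [||dG Gf] := @continuous_FTC1_closed R f (-1) x (x + 1) _ _ x1 (fc x).
  - by rewrite ltrDl.
  - apply: continuous_compact_integrable; first exact: segment_compact.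
    exact: continuous_subspaceT.
  by split; [exact: dG|rewrite -derive1E; exact: Gf].
pose p (x : R) : R := Num.max x 0.
have pc : continuous p by exact: continuous_maxr_cst.
exists (fun x => G (p x) - G 0); split.
- move=> x; apply: cvgB; last exact: cvg_cst.
  have x1 : -1 < p x by rewrite lt_max ltrN10 orbT.
  have [/derivable1_diffP /differentiable_continuous Gc _] := Gd _ x1.
  exact: cvg_comp (pc x) Gc.
- by rewrite /p maxxx subrr.
- move=> x x0; have x1 : -1 < x by apply: lt_trans x0; rewrite ltrN10.
  apply: (@near_eq_is_derive _ _ _ (fun x => G x - G 0)).
  + near=> z; rewrite /p max_l//; apply: ltW; near: z.
    exact: lt_nbhsr.
  + by have := Gd x x1 => Gx; apply: is_derive_eq; rewrite subr0.
Unshelve. all: by end_near. Qed.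

Lemma linear_ode {m : nat} (B : 'M[R]_m) (z g : R -> 'cV[R]_m) :
  continuous z -> continuous g ->
  exists w : R -> 'cV[R]_m, [/\ continuous w, forall t, t <= 0 -> w t = z t &
    forall t : R, 0 < t -> is_derive t (1 : R) w (B *m w t + g t)].
Proof.
move=> zc gc; pose f t := expmx ((- t) *: B) *m g t.
have fc : continuous f.
  move=> t; apply: cvg_mulmx (gc t).
  by apply: cvg_expmx_comp; exact: cvgN.
have [H Hf] := choice (fun i => @antiderivative (fun t => f t i 0)
  (fun t => (cvg_mxP _ _).1 (fc t) i 0)).
pose p (t : R) : R := Num.max t 0; pose n (t : R) : R := Num.min t 0.
have pc : continuous p by exact: continuous_maxr_cst.
have nc : continuous n by exact: continuous_minr_cst.
pose h t : 'cV[R]_m := \col_i H i (p t).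
(* Prescribed past and variation of constants in one formula: for t <= 0 the last term is [z 0], for
   t >= 0 the first two cancel. The clamped times make continuity at 0 automatic. *)
pose w t := z (n t) - z 0 + expmx (p t *: B) *m (z 0 + h t).
exists w; split.
- move=> t; apply: cvgD.
    by apply: cvgB; [exact: cvg_comp (nc t) (zc _)|exact: cvg_cst].
  apply: cvg_mulmx; first by apply: cvg_expmx_comp; exact: pc.
  apply: cvgD; first exact: cvg_cst.
  apply/cvg_mxP => i j; rewrite mxE; under eq_fun do rewrite mxE.
  by have [Hc _ _] := Hf i; exact: cvg_comp (pc t) (Hc _).
- move=> t t0; rewrite /w /n /p min_l// max_r// scale0r expmx0 mul1mx.
  have -> : h t = 0.
    by apply/matrixP => i j; rewrite !mxE /p max_r//; have [_ -> _] := Hf i.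
  by rewrite addr0 subrK.
- move=> t t0; rewrite {2}/w /n /p (min_r (ltW t0)) subrr add0r (max_l (ltW t0)).
  apply: (@near_eq_is_derive R R 'cV[R]_m
      (fun t => expmx (t *: B) *m (z 0 + \col_i H i t))).
  + near=> s; have s0 : 0 <= s by apply: ltW; near: s; exact: lt_nbhsr.
    by rewrite /w /h /n /p min_r// max_l// subrr add0r.
  have dz : is_derive t (1 : R) (fun t => z 0 + \col_i H i t) (f t).
    apply/is_derive_mxP => i j; rewrite ord1.
    have -> : (fun t => (z 0 + \col_i H i t) i 0) = (fun t => z 0 i 0 + H i t).
      by apply/funext => s; rewrite !mxE.
    have [_ _ /(_ t t0) dH] := Hf i.
    have dz := is_derive_cst (z 0 i 0 : R^o) t (1 : R).
    by apply: (is_derive_eq (is_deriveD dz dH)); rewrite add0r.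
  apply: (is_derive_eq (is_derive_mulmx (is_derive_expmx B t) dz)).
  rewrite mulmxA /f mulmxA -expmxD subrr scale0r expmx0 mul1mx /h /p.
  by rewrite (max_l (ltW t0)).
Unshelve. all: by end_near. Qed.

End LinearEquation.

(** * Gronwall's lemma for delay equations, and history segments *)

(* At the first time where [|e|] meets the barrier [g], the quantity [|e| - g]
   has a negative slope, which is impossible as it was negative before. *)
Lemma gronwall_delay {R : realType} {m : nat} (r T L d eta : R)
    (e de : R -> 'cV[R]_m) : 0 <= r -> 0 <= L -> 0 < d -> continuous e ->
  (forall s, - r <= s -> s <= 0 -> `|e s| <= d) ->
  (forall t : R, 0 < t -> t < T -> is_derive t (1 : R) e (de t)) ->
  (forall t c, 0 < t -> t < T -> c <= eta ->
     (forall s, t - r <= s -> s <= t -> `|e s| <= c) -> `|de t| <= L * c + d) ->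
  2 * d * expR ((L + 1) * T) <= eta ->
  forall t, 0 <= t -> t <= T -> `|e t| <= 2 * d * expR ((L + 1) * t).
Proof.
move=> r0 L0 d0 ec e0 ede de_le eta_ge.
(* The factor 2 puts the barrier strictly above [d] at time 0. The 1 added to [L] absorbs the
   additive [d] in the bound on [de], since [d < g] from then on. *)
pose g t := 2 * d * expR ((L + 1) * t).
have dg (t : R) : is_derive t (1 : R) g ((L + 1) * g t).
  have dl : is_derive t (1 : R) (fun t => (L + 1) * t) (L + 1).
    by apply: is_derive_eq; rewrite [_ *: _]mulr1.
  have dx := @is_derive1_comp R expR (fun t => (L + 1) * t) t _ _
    (is_derive_expR _) dl.
  apply: (is_derive_eq (is_deriveZ (2 * d) dx)).
  by rewrite -[_ *: _]/(_ * _) mulrA mulrC.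
have gc : continuous g.
  by move=> t; have [/derivable1_diffP /differentiable_continuous] := dg t.
have d2 : 0 < 2 * d by rewrite mulr_gt0.
have L1 : 0 < L + 1 by rewrite ltr_wpDl.
have g_le s t : s <= t -> g s <= g t.
  by move=> st; rewrite ler_pM2l// ler_expR ler_pM2l.
have g0 : d < g 0 by rewrite /g mulr0 expR0 mulr1; lra.
move=> t t0 tT; rewrite leNgt; apply/negP => gt_lt.
pose A := [set t | [/\ 0 <= t, t <= T & g t <= `|e t|]].
have A0 : has_inf A.
  by split; [exists t; split=> //; exact: ltW|exists 0 => x []].
pose t1 := inf A.
have t1_le x : A x -> t1 <= x by apply: ge_inf; case: A0.
have t1_ge0 : 0 <= t1 by apply: lb_le_inf; [case: A0|move=> x []].
have t1T : t1 <= T.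
  by apply: (le_trans _ tT); apply: t1_le; split=> //; exact: ltW.
have t1A : g t1 <= `|e t1|.
  rewrite leNgt; apply/negP => et1.
  have hc : (fun x => `|e x| - g x : R) x @[x --> t1] --> `|e t1| - g t1.
    by apply: cvgB; [apply: cvg_norm; exact: ec|exact: gc].
  have h0 : `|e t1| - g t1 < 0 by rewrite subr_lt0.
  have : \forall x \near t1, `|e x| - g x < 0 by exact: (cvgr_lt _ hc _ h0).
  move=> /nbhs_ballP[rho /= rho0 hrho].
  have [x Ax xt1] := inf_adherent rho0 A0.
  have t1x := t1_le _ Ax.
  have : ball t1 rho x.
    by rewrite /ball/= ler0_norm ?subr_le0// opprB ltrBlDl.
  by move=> /hrho; case: Ax => _ _ gx; rewrite /= subr_lt0 ltNge gx.
have t1_gt0 : 0 < t1.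
  rewrite lt_neqAle t1_ge0 andbT; apply/eqP => t10; move: t1A.
  rewrite -t10 leNgt => /negP; apply; apply: le_lt_trans g0.
  by apply: e0 => //; rewrite lerNl oppr0.
have lt_g s : 0 <= s -> s < t1 -> `|e s| < g s.
  move=> s0 st1; rewrite ltNge; apply/negP => gs.
  have : t1 <= s by apply: t1_le; split=> //; exact: le_trans (ltW st1) t1T.
  by rewrite leNgt st1.
(* [c] will be the sign of a coordinate realizing the maximum norm at [t1]. Working with c e_i - g
   keeps the function differentiable, and the mean value theorem on [0, t1] shows that it ends below
   its negative initial value. *)
have key (c : R) i : `|c| = 1 -> c * e t1 i 0 < g t1.
  move=> c1; pose h t := c * e t i 0 - g t.
  have hd (x : R) : x \in `]0, t1[ ->
      is_derive x (1 : R) h (c * de x i 0 - (L + 1) * g x).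
    rewrite in_itv/= => /andP[x0 xt1].
    have := ede x x0 (lt_le_trans xt1 t1T).
    move=> /is_derive_mxP /(_ i 0) dei.
    exact: is_deriveB (is_deriveZ c dei) (dg x).
  have hc : {within `[0, t1], continuous h}.
    apply: continuous_subspaceT => x; apply: cvgB; last exact: gc.
    by apply: cvgMr; apply: (cvg_mxP _ _).1; exact: ec.
  have [x] := MVT t1_gt0 hd hc; rewrite in_itv/= => /andP[x0 xt1].
  rewrite subr0 => hx.
  have hle : c * de x i 0 <= L * g x + d.
    apply: (@le_trans _ _ `|de x|).
      apply: le_trans (ler_norm_entry (de x) i 0).
      by rewrite (le_trans (ler_norm _))// normrM c1 mul1r.
    apply: de_le => //; first exact: lt_le_trans xt1 t1T.
      by apply: le_trans eta_ge; apply: g_le; exact: le_trans (ltW xt1) t1T.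
    move=> s xs sx; have [s0|s0] := leP 0 s.
      apply: le_trans (g_le _ _ sx); apply: ltW; apply: lt_g => //.
      exact: le_lt_trans sx xt1.
    apply: le_trans (g_le 0 x (ltW x0)); apply: le_trans (ltW g0).
    apply: e0 (ltW s0); apply: le_trans xs; rewrite -[leLHS]add0r lerD2r.
    exact: ltW.
  have h0 : h 0 <= d - g 0.
    rewrite lerD2r (le_trans (ler_norm _))// normrM c1 mul1r.
    by rewrite (le_trans (ler_norm_entry _ _ _))// e0// lerNl oppr0.
  have gx : d < g x by apply: lt_le_trans g0 (g_le _ _ (ltW x0)).
  have : (c * de x i 0 - (L + 1) * g x) * t1 < 0.
    by rewrite pmulr_llt0//; lra.
  rewrite -hx /h; rewrite /h in h0; lra.
have /mx_norm_neq0[[i j] /= ei] : mx_norm (e t1) != 0.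
  by rewrite gt_eqF//; apply: lt_le_trans t1A; rewrite mulr_gt0// expR_gt0.
move: t1A; rewrite leNgt => /negP; apply.
rewrite [ltLHS]ei ord1; have [_|_] := ger0P (e t1 i 0).
  by have := key 1 i; rewrite normr1 mul1r; exact.
by have := key (-1) i; rewrite normrN1 mulN1r; exact.
Qed.

(** * History segments and membership in the cone *)

Section Segments.
Context {R : realType} {m : nat} {r : R} (B : 'M[R]_m).
Implicit Types (u v : R -> 'cV[R]_m).

Lemma segment_atE u t s : continuous u -> - r <= s -> s <= 0 ->
  segment_at r u t s = u (t + s).
Proof.
move=> uc rs s0; rewrite /segment_at cseg_ofE//; last by rewrite in_itv/= rs.
apply: continuous_subspaceT => x.
have tc : t + x @[x --> x] --> t + x.
  by apply: cvgD; [exact: cvg_cst|exact: cvg_id].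
exact: cvg_comp tc (uc _).
Qed.

Lemma segment_atB u v t : continuous u -> continuous v ->
  segment_at r (fun s => u s - v s) t = segment_at r u t - segment_at r v t.
Proof.
move=> uc vc; apply: csegP => s; rewrite in_itv/= => /andP[rs s0].
rewrite -[RHS]/(segment_at r u t s - segment_at r v t s).
rewrite !segment_atE// => x; apply: cvgB; [exact: uc|exact: vc].
Qed.

Lemma norm_segment_at_le u t c : continuous u -> 0 <= c ->
  (forall s, t - r <= s -> s <= t -> `|u s| <= c) -> `|segment_at r u t| <= c.
Proof.
move=> uc c0 ule; apply: cseg_norm_le => // s; rewrite in_itv/= => /andP[rs s0].
by rewrite segment_atE//; apply: ule; [rewrite lerD2l|rewrite gerDl].
Qed.

Lemma KB_segment_atP u t : continuous u ->
  KB B (segment_at r u t) <->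
  (forall s, t - r <= s -> s <= t -> vle 0 (u s)) /\
  (forall s s', t - r <= s -> s <= s' -> s' <= t ->
     vle (expmx ((s' - s) *: B) *m u s) (u s')).
Proof.
move=> uc; split=> -[H0 H1]; split.
- move=> s ts st; have st0 : s - t <= 0 by rewrite subr_le0.
  have rst : - r <= s - t by rewrite lerBrDl.
  have := H0 (s - t); rewrite in_itv/= rst st0 (segment_atE _ uc)// subrKC.
  exact.
- move=> s s' ts ss' s't; have s't0 : s' - t <= 0 by rewrite subr_le0.
  have rst : - r <= s - t by rewrite lerBrDl.
  have sst : s - t <= s' - t by rewrite lerD2r.
  have := H1 _ _ rst sst s't0.
  rewrite (segment_atE _ uc)// ?(le_trans sst)//.
  rewrite (segment_atE _ uc)// ?(le_trans rst)// !subrKC.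
  by rewrite (_ : s' - t - (s - t) = s' - s); last by ring.
- move=> s; rewrite in_itv/= => /andP[rs s0]; rewrite segment_atE//.
  by apply: H0; [rewrite lerD2l|rewrite gerDl].
- move=> s s' rs ss' s0.
  rewrite (segment_atE _ uc rs (le_trans ss' s0)).
  rewrite (segment_atE _ uc (le_trans rs ss') s0).
  rewrite (_ : s' - s = (t + s') - (t + s)); last by ring.
  by apply: H1; [rewrite lerD2l|rewrite lerD2l|rewrite gerDl].
Qed.

(** A pair of times straddling 0 is split at 0 by the semigroup property: the cone condition at time
    0 covers the past, the differential inequality covers the future, and no derivative at 0 or
    earlier is required. *)
Lemma KB_segment_at u du t : 0 <= r -> quasipositive B -> continuous u ->
  KB B (segment_at r u 0) ->
  (forall s : R, 0 < s -> s < t -> is_derive s (1 : R) u (du s)) ->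
  (forall s, 0 < s -> s < t -> vle (B *m u s) (du s)) ->
  0 <= t -> KB B (segment_at r u t).
Proof.
move=> r0 qB uc /(KB_segment_atP _ uc)[u0 u1] udu Bdu t0.
have le2 s s' : 0 <= s -> s <= s' -> s' <= t ->
    vle (expmx ((s' - s) *: B) *m u s) (u s').
  move=> s0 ss' s't; apply: (@expmx_le R m B qB u du) => // x sx xs'.
    by apply: udu; [exact: le_lt_trans sx|exact: lt_le_trans s't].
  by apply: Bdu; [exact: le_lt_trans sx|exact: lt_le_trans s't].
rewrite sub0r in u0 u1.
have u00 : vle 0 (u 0) by apply: u0 => //; rewrite oppr_le0.
have vle_trans (a b c : 'cV[R]_m) : vle a b -> vle b c -> vle a c.
  by move=> ab bc i; exact: le_trans (ab i) (bc i).
apply/KB_segment_atP => //; split=> [s ts st|s s' ts ss' s't].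
  have rs : - r <= s by apply: le_trans ts; rewrite -[leLHS]add0r lerD2r.
  have [s0|s0] := leP s 0; first exact: u0.
  have := le2 0 s (lexx _) (ltW s0) st; rewrite subr0; apply: vle_trans.
  by have := vle_mulmx_expmx qB (ltW s0) u00; rewrite mulmx0.
have rs : - r <= s by apply: le_trans ts; rewrite -[leLHS]add0r lerD2r.
have [s0|s0] := leP 0 s; first exact: le2.
have [s'0|s'0] := leP s' 0; first exact: u1.
apply: (vle_trans _ (expmx (s' *: B) *m u 0)); last first.
  by have := le2 0 s' (lexx _) (ltW s'0) s't; rewrite subr0.
rewrite expmxD -mulmxA; apply: vle_mulmx_expmx (ltW s'0) _ => //.
by have := u1 s 0 rs (ltW s0) (lexx _); rewrite sub0r.
Qed.

(** At each s, continuity of [u] at t + s controls all nearby pairs of times; compactness of [-r, 0]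
    makes the control uniform in s, as the sup norm demands. *)
Lemma continuous_segment_at u : continuous u -> continuous (segment_at r u).
Proof.
move=> uc t; apply/cvgrPdist_le => e e0.
have /compact_near_coveringP cov := @segment_compact R (- r) 0.
pose P (t' s : R) := `|u (t + s) - u (t' + s)| <= e.
have {}cov : \forall t' \near t, `[- r, 0] `<=` P t'.
  apply: (cov R (nbhs t) P) => s _.
  have e2 : 0 < e / 2 by rewrite divr_gt0.
  have /cvgrPdist_le/(_ _ e2) := uc (t + s).
  move=> /nbhs_ballP[d /= d0 ud].
  exists (ball s (d / 2), ball t (d / 2)) => /=.
    by split; apply: nbhsx_ballx; rewrite divr_gt0.
  move=> [s' t']/= [/=]; rewrite /ball/= => ss' tt'; rewrite /P.
  rewrite (_ : u (t + s') - u (t' + s') =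
    (u (t + s) - u (t' + s')) - (u (t + s) - u (t + s'))); last first.
    by rewrite opprB [RHS]addrC subrKA.
  rewrite (le_trans (ler_normB _ _))// (splitr e) lerD//; apply: ud.
    rewrite /ball/= (_ : t + s - (t' + s') = (t - t') + (s - s')); last by ring.
    by rewrite (le_lt_trans (ler_normD _ _))// (splitr d) ltrD.
  rewrite /ball/= (_ : t + s - (t + s') = s - s'); last by ring.
  by rewrite (lt_trans ss')// ltr_pdivrMr// ltr_pMr// ltr1n.
apply: filterS cov => t' ut'; apply: cseg_norm_le (ltW e0) _ => s rs.
have -> : (segment_at r u t - segment_at r u t') s =
  segment_at r u t s - segment_at r u t' s by [].
have := rs; rewrite in_itv/= => /andP[rs' s0].
by rewrite !segment_atE//; exact: ut'.
Qed.

End Segments.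

(** * Lipschitz estimates along a curve *)

Lemma is_derive_along_line {R : realType} {V W : normedModType R} (f : V -> W)
    (x h : V) (s : R) : differentiable f (x + s *: h) ->
  is_derive s (1 : R) (fun t => f (x + t *: h)) ('d f (x + s *: h) h).
Proof.
move=> df; have eq : (fun k : R => k^-1 *:
    (((fun t => f (x + t *: h)) \o shift s) (k *: (1 : R)) - f (x + s *: h))) =
    (fun k : R => k^-1 *: ((f \o shift (x + s *: h)) (k *: h) - f (x + s *: h))).
  apply/funext => k /=; congr (_ *: (f _ - _)).
  by rewrite -[k *: 1]/(k * 1) mulr1 scalerDl addrCA.
split; rewrite /derivable /derive eq; first exact: diff_derivable.
exact: deriveE.
Qed.

Section DelayEquation.
Context {R : realType} {Omega : metricType R} (sigma : R -> Omega -> Omega).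
Context {m : nat} {r : R} (F : Omega -> cseg r 'cV[R]_m -> 'cV[R]_m).
Local Notation X := (cseg r 'cV[R]_m).

(* The derivative of F in its second variable is bounded near (w0, phi0): apply
   the mean value theorem along the segment from phi to psi. *)
Lemma locally_lipschitz (w0 : Omega) (phi0 : X) : C1_snd F ->
  exists L eta : R, [/\ 0 <= L, 0 < eta & \forall w \near w0, forall phi psi,
    `|phi0 - phi| < eta -> `|phi0 - psi| < eta ->
    `|F w psi - F w phi| <= L * `|psi - phi|].
Proof.
move=> [dF cF]; have [C C0 HC] : exists2 C : R, 0 <= C &
    forall h, `|'d (F w0) phi0 h| <= C * `|h|.
  have : continuous ('d (F w0) phi0) by exact: diff_continuous (dF w0 phi0).
  move=> /linear_bounded_continuous /linear_boundedP /pinfty_ex_gt0[C C0 HC].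
  by exists C => //; exact: ltW.
(* Tolerance 1 in the continuity of the derivative: its operator norm stays below [C + 1] near (w0,
   phi0). *)
have [[U V]/= [nU nV] UV] := cF w0 phi0 1 ltr01.
move: nV => /nbhs_normP[eta /= eta0 etaV].
exists (C + 1), eta; split=> //; first by rewrite addr_ge0.
apply: filterS nU => w Uw phi psi phieta psieta.
set h := psi - phi.
have ball_line s : 0 <= s -> s <= 1 -> `|phi0 - (phi + s *: h)| < eta.
  move=> s0 s1.
  have -> : phi0 - (phi + s *: h) =
      (1 - s) *: (phi0 - phi) + s *: (phi0 - psi).
    have -> : h = (phi0 - phi) - (phi0 - psi) by rewrite opprB [RHS]addrC subrKA.
    rewrite opprD addrA scalerBr opprB scalerBl scale1r -[RHS]addrA.
    by congr (_ + _); rewrite addrC.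
  apply: le_lt_trans (ler_normD _ _) _; rewrite !normrZ.
  rewrite (ger0_norm s0) ger0_norm ?subr_ge0//.
  have [->|sn0] := eqVneq s 0; first by rewrite subr0 mul1r mul0r addr0.
  have sp : 0 < s by rewrite lt_neqAle eq_sym sn0.
  have -> : eta = (1 - s) * eta + s * eta by ring.
  by rewrite ler_ltD// ?ler_wpM2l ?subr_ge0// ?ltr_pM2l// ltW.
have dh s : 0 <= s -> s <= 1 -> `|'d (F w) (phi + s *: h) h| <= (C + 1) * `|h|.
  move=> s0 s1; have Vs := etaV _ (ball_line s s0 s1).
  have /= := UV (w, phi + s *: h) (conj Uw Vs) h.
  move=> dd; rewrite mulrDl -lerBlDl; apply: le_trans dd.
  apply: le_trans (lerB_dist _ _); rewrite lerD2l lerN2; exact: HC.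
apply: ler_mx_norm => [|i j]; first by rewrite mulr_ge0 ?addr_ge0.
rewrite ord1 => {j}.
pose k s := F w (phi + s *: h) i 0.
pose dk s := ('d (F w) (phi + s *: h) h) i 0.
have kd (s : R) : is_derive s (1 : R) k (dk s).
  by apply: (is_derive_mxP _ _ _).1; apply: is_derive_along_line; exact: dF.
have kc : {within `[0, 1], continuous k}.
  apply: continuous_subspaceT => s.
  by have [/derivable1_diffP /differentiable_continuous] := kd s.
have [s] := @MVT_segment R k dk 0 1 ler01 (fun s _ => kd s) kc.
rewrite in_itv/= subr0 mulr1 /k scale0r addr0 scale1r => /andP[s0 s1].
rewrite /h subrKC => eq; rewrite !mxE eq.
exact: le_trans (ler_norm_entry _ _ _) (dh s s0 s1).
Qed.

Hypothesis sigmaP : continuous_flow sigma.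

Lemma continuous_flow_time w : continuous (fun t => sigma t w).
Proof.
move=> t A nA; have [sc _ _] := sigmaP.
have [[U V]/= [nU nV] UV] := sc (t, w) A nA.
by apply: filterS nU => s Us; apply: (UV (s, w)); split=> //;
  exact: nbhs_singleton.
Qed.

Lemma lipschitz_near_curve (w0 : Omega) (T : R) (q : R -> X) :
  C1_snd F -> continuous q ->
  exists L eta : R, [/\ 0 <= L, 0 < eta & \forall w \near w0, forall t phi psi,
    0 <= t -> t <= T -> `|q t - phi| <= eta -> `|q t - psi| <= eta ->
    `|F (sigma t w) psi - F (sigma t w) phi| <= L * `|psi - phi|].
Proof.
move=> dF qc; have [sc _ _] := sigmaP.
have /compact_near_coveringP cov := @segment_compact R 0 T.
(* One natural number n encodes both constants, as L = n and eta = 1/(n+1). The property weakens as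
   n grows, so choosing constants uniformly on [0, T] becomes a compactness statement for the filter
   at infinity. *)
pose P (p : Omega * nat) t := forall phi psi,
  `|q t - phi| <= p.2.+1%:R^-1 -> `|q t - psi| <= p.2.+1%:R^-1 ->
  `|F (sigma t p.1) psi - F (sigma t p.1) phi| <= p.2%:R * `|psi - phi|.
have {}cov : \forall p \near filter_prod (nbhs w0) \oo, `[0, T] `<=` P p.
  apply: (cov _ _ P) => t _.
  have [L [eta [L0 eta0 HL]]] := locally_lipschitz (sigma t w0) (q t) dF.
  have eta2 : 0 < eta / 2 by rewrite divr_gt0.
  have [[Ut Uw]/= [nUt nUw] HU] := sc (t, w0) _ HL.
  have nq : \forall t' \near t, `|q t - q t'| < eta / 2.
    by move/cvgrPdist_lt : (qc t); exact.
  have nn : \forall n \near \oo, n.+1%:R^-1 < eta / 2 /\ L <= n%:R.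
    near=> n; split; near: n; first exact: near_infty_natSinv_lt (PosNum eta2).
    exact: nbhs_infty_ger.
  exists (Ut `&` [set t' | `|q t - q t'| < eta / 2],
    Uw `*` [set n | n.+1%:R^-1 < eta / 2 /\ L <= n%:R]).
    split; first exact: filterI.
    by exists (Uw, [set n | n.+1%:R^-1 < eta / 2 /\ L <= n%:R]).
  move=> [t' [w n]]/= [[Utt' qt'] [Uww [n2 Ln]]] phi psi phin psin.
  have close chi : `|q t' - chi| <= n.+1%:R^-1 -> `|q t - chi| < eta.
    move=> chin; rewrite -(subrKA (q t')) (le_lt_trans (ler_normD _ _))//.
    by rewrite (splitr eta) ltrD// (le_lt_trans chin).
  have := HU (t', w) (conj Utt' Uww) phi psi (close _ phin) (close _ psin).
  by move=> /le_trans; apply; rewrite ler_wpM2r.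
case: cov => -[U N]/= [nU nN] UN.
have [n Nn] : exists n, N n by exact: filter_ex nN.
exists n%:R, n.+1%:R^-1; split; rewrite ?invr_gt0//.
apply: filterS nU => w Uw t phi psi t0 tT.
by apply: (UN (w, n)) => //=; rewrite in_itv/= t0.
Unshelve. all: by end_near. Qed.

Hypothesis Fc : continuous (fun p : Omega * X => F p.1 p.2).

Lemma near_curve_continuous (w0 : Omega) (T e : R) (q : R -> X) :
  0 < e -> continuous q ->
  \forall w \near w0, forall t, 0 <= t -> t <= T ->
    `|F (sigma t w) (q t) - F (sigma t w0) (q t)| <= e.
Proof.
move=> e0 qc; have [sc _ _] := sigmaP.
have /compact_near_coveringP cov := @segment_compact R 0 T.
pose P w t := `|F (sigma t w) (q t) - F (sigma t w0) (q t)| <= e.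
have {}cov : \forall w \near w0, `[0, T] `<=` P w.
  apply: (cov _ _ P) => t _.
  have e2 : 0 < e / 2 by rewrite divr_gt0.
  have /cvgrPdist_lt/(_ _ e2) := @Fc (sigma t w0, q t).
  move=> [[U V]/= [nU nV] UV].
  have [[Ut Uw]/= [nUt nUw] HU] := sc (t, w0) _ nU.
  exists (Ut `&` q @^-1` V, Uw).
    by split=> //; apply: filterI => //; exact: qc.
  move=> [t' w]/= [[Utt' Vt'] Uww].
  have H1 := UV (sigma t' w, q t') (conj (HU (t', w) (conj Utt' Uww)) Vt').
  have w0U : Uw w0 by exact: nbhs_singleton.
  have H2 := UV (sigma t' w0, q t') (conj (HU (t', w0) (conj Utt' w0U)) Vt').
  rewrite /P -(subrKA (F (sigma t w0) (q t))) (le_trans (ler_normD _ _))//.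
  by rewrite (splitr e) lerD// ltW// distrC.
apply: filterS cov => w Pw t t0 tT; apply: Pw.
by rewrite /= in_itv/= t0.
Qed.

End DelayEquation.

(** * Comparison and continuous dependence *)

Section Comparison.
Context {R : realType} {Omega : metricType R} (sigma : R -> Omega -> Omega).
Context {m : nat} {r : R} (F : Omega -> cseg r 'cV[R]_m -> 'cV[R]_m).
Local Notation X := (cseg r 'cV[R]_m).
Hypothesis r0 : 0 <= r.
Hypothesis sigmaP : continuous_flow sigma.
Hypothesis Fc : continuous (fun p : Omega * X => F p.1 p.2).
Hypothesis dF : C1_snd F.

(** Solutions are taken continuous on the whole line, which avoids subspace topologies. A two-sided
    derivative at positive times is enough, since all estimates rest on mean values over open
    intervals. *)
Definition solves (w : Omega) (y : R -> 'cV[R]_m) :=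
  continuous y /\ forall t : R, 0 < t ->
    is_derive t (1 : R) y (F (sigma t w) (segment_at r y t)).

Lemma continuous_vector_field w (y : R -> 'cV[R]_m) : continuous y ->
  continuous (fun t => F (sigma t w) (segment_at r y t)).
Proof.
move=> yc t A nA.
have [[U V]/= [nU nV] UV] := @Fc (sigma t w, segment_at r y t) A nA.
have nU' : \forall s \near t, U (sigma s w).
  exact: (@continuous_flow_time _ _ _ sigmaP w t U nU).
have nV' : \forall s \near t, V (segment_at r y s).
  exact: (@continuous_segment_at _ _ r y yc t V nV).
apply: filterS2 nU' nV' => s Us Vs; exact: (UV (_, _) (conj Us Vs)).
Qed.

Lemma continuous_dependence w0 (y0 : R -> 'cV[R]_m) (T e : R) :
  solves w0 y0 -> 0 < e -> exists2 d : R, 0 < d & \forall w \near w0, forall y,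
    solves w y -> (forall s, - r <= s -> s <= 0 -> `|y s - y0 s| <= d) ->
    forall t, 0 <= t -> t <= T -> `|y t - y0 t| <= e.
Proof.
move=> [y0c y0d] e0.
have qc := @continuous_segment_at R m r y0 y0c.
have [L [eta [L0 eta0 HL]]] := lipschitz_near_curve sigmaP w0 T dF qc.
pose M := 2 * expR ((L + 1) * T).
have M0 : 0 < M by rewrite mulr_gt0// expR_gt0.
(* With this [d] the Gronwall barrier at time [T] is exactly [min e eta]: within the required error,
   and inside the tube around y0 where the Lipschitz bound holds. *)
pose d := Num.min e eta / M.
have d0 : 0 < d by rewrite divr_gt0// lt_min e0.
have dM : 2 * d * expR ((L + 1) * T) = Num.min e eta.
  by rewrite mulrAC mulrC divfK// gt_eqF.
exists d => //; have HF := near_curve_continuous sigmaP Fc w0 T d0 qc.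
near=> w => y [yc yd] y_d t t0 tT.
have zc : continuous (fun s => y s - y0 s).
  by move=> s; apply: cvgB; [exact: yc|exact: y0c].
apply: (@le_trans _ _ (2 * d * expR ((L + 1) * t))); last first.
  apply: (@le_trans _ _ (2 * d * expR ((L + 1) * T))).
    by rewrite ler_wpM2l ?ler_expR ?ler_wpM2l ?addr_ge0// mulr_ge0// ltW.
  by rewrite dM ge_min lexx.
apply: (@gronwall_delay R m r T L d eta (fun s => y s - y0 s)
  (fun t => F (sigma t w) (segment_at r y t) -
            F (sigma t w0) (segment_at r y0 t))) => //.
- by move=> s s0 sT; apply: is_deriveB; [exact: yd|exact: y0d].
- move=> s c s0 sT ceta cle.
  have c0 : 0 <= c.
    by apply: le_trans (normr_ge0 _) (cle s _ (lexx _)); rewrite gerBl.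
  have yle : `|segment_at r y s - segment_at r y0 s| <= c.
    by rewrite -segment_atB//; exact: norm_segment_at_le.
  rewrite -(subrKA (F (sigma s w) (segment_at r y0 s))).
  rewrite (le_trans (ler_normD _ _))// lerD//.
    apply: (@le_trans _ _ (L * `|segment_at r y s - segment_at r y0 s|)).
      have : forall t phi psi, 0 <= t -> t <= T ->
        `|segment_at r y0 t - phi| <= eta -> `|segment_at r y0 t - psi| <= eta ->
        `|F (sigma t w) psi - F (sigma t w) phi| <= L * `|psi - phi|.
        by near: w.
      apply => //; [exact: ltW|exact: ltW|by rewrite subrr normr0 ltW|].
      by rewrite distrC (le_trans yle).
    by rewrite ler_wpM2l.
  move: s {cle yle} s0 sT => s s0 sT.
  have : forall t, 0 <= t -> t <= T -> `|F (sigma t w) (segment_at r y0 t) -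
    F (sigma t w0) (segment_at r y0 t)| <= d by near: w.
  by apply; exact: ltW.
- by rewrite dM ge_min lexx orbT.
Unshelve. all: by end_near. Qed.

Context (B : 'M[R]_m).
Hypothesis qB : quasipositive B.
Hypothesis F_mono : forall w (phi psi : X), leB B phi psi ->
  vle (B *m (psi 0 - phi 0)) (F w psi - F w phi).

(* The solution [v] of v' = B v + ((y - x)' - B (y - x))^+ that extends y - x
   satisfies v_t >=_B 0 and v_t >=_B (y - x)_t. Monotonicity of [F] between x
   and x + v bounds the defect d = v - (y - x) by d' <= C |d_t|, so that
   Gronwall's lemma gives v = y - x. *)
Lemma comparison w (x dx y : R -> 'cV[R]_m) : continuous x -> continuous dx ->
  (forall t : R, 0 < t -> is_derive t (1 : R) x (dx t)) ->
  (forall t, 0 < t -> vle (dx t) (F (sigma t w) (segment_at r x t))) ->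
  solves w y -> leB B (segment_at r x 0) (segment_at r y 0) ->
  forall t, 0 <= t -> leB B (segment_at r x t) (segment_at r y t).
Proof.
move=> xc dxc xd dx_le [yc yd] xy0.
pose dy t := F (sigma t w) (segment_at r y t).
have dyc : continuous dy by exact: continuous_vector_field.
pose z t := y t - x t.
have zc : continuous z by move=> t; apply: cvgB; [exact: yc|exact: xc].
pose G t := dy t - dx t - B *m z t.
have Gc : continuous G.
  move=> t; apply: cvgB; first by apply: cvgB; [exact: dyc|exact: dxc].
  by apply: cvg_mulmx; [exact: cvg_cst|exact: zc].
pose pos (x : R) : R := Num.max x 0.
have posc : continuous pos by exact: continuous_maxr_cst.
pose Gp t : 'cV[R]_m := \col_i pos (G t i 0).
have Gpc : continuous Gp.
  move=> t; apply/cvg_mxP => i j.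
  have -> : (fun s => Gp s i j) = (fun s => pos (G s i 0)).
    by apply/funext => s; rewrite mxE.
  have Gi : continuous (fun s => G s i 0 : R).
    by move=> s; apply: (cvg_mxP _ _).1; exact: Gc.
  rewrite mxE.
  exact: (@continuous_comp _ _ _ (fun s => G s i 0) pos t (Gi t) (posc _)).
have [v [vc vz vd]] := linear_ode B zc Gpc.
pose d t := v t - z t.
have dc : continuous d by move=> t; apply: cvgB; [exact: vc|exact: zc].
pose dd t := B *m d t + (Gp t - G t).
have ddP (t : R) : 0 < t -> is_derive t (1 : R) d (dd t).
  move=> t0; have dz := is_deriveB (yd t t0) (xd t t0).
  apply: (is_derive_eq (is_deriveB (vd t t0) dz)).
  rewrite /dd /G mulmxBr -/(dy t); move: (dy t - dx t) => D.
  by rewrite opprB [Gp t + _]addrCA subrKA addrA.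
have d_le0 t : t <= 0 -> d t = 0 by move=> t0; rewrite /d vz// subrr.
have Gp_ge t i : 0 <= (Gp t - G t) i 0.
  by rewrite !mxE subr_ge0 /pos le_max lexx.
have KBz0 : KB B (segment_at r z 0) by rewrite segment_atB.
have KBv t : 0 <= t -> KB B (segment_at r v t).
  move=> t0; apply: (@KB_segment_at _ _ _ _ v (fun t => B *m v t + Gp t)) => //.
  - rewrite (_ : segment_at r v 0 = segment_at r z 0)//.
    apply: csegP => s; rewrite in_itv/= => /andP[rs s0].
    by rewrite !segment_atE// add0r vz.
  - by move=> s s0 _; exact: vd.
  - by move=> s s0 _ i; rewrite [leRHS]mxE lerDl mxE /pos le_max lexx orbT.
have d_KB t : 0 <= t -> KB B (segment_at r d t).
  move=> t0; apply: (@KB_segment_at _ _ _ _ d dd) => //.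
  - apply/KB_segment_atP => //; rewrite sub0r.
    by split=> [s _ s0|s s' _ ss' s0]; rewrite !d_le0 ?mulmx0// (le_trans ss').
  - by move=> s s0 _; exact: ddP.
  - by move=> s s0 _ i; rewrite [leRHS]mxE lerDl.
pose p t := x t + v t.
have pc : continuous p by move=> t; apply: cvgD; [exact: xc|exact: vc].
have pE t : p t = y t + d t by rewrite /p /d /z opprB addrCA subrKC addrC.
have at0 u t : continuous u -> segment_at r u t 0 = u t.
  by move=> uc; rewrite segment_atE ?addr0// oppr_le0.
(* Where [G] has a negative coordinate, the left side is that of dx + B z - dy. Bounding dx by F at
   x, then F at x by F at p minus B(z + d), cancels B z and leaves only terms that are small with
   d. *)
have Gp_le t i : 0 < t -> (Gp t - G t) i 0 <=
    `|F (sigma t w) (segment_at r p t) - dy t - B *m d t|.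
  move=> t0; have := @F_mono (sigma t w) (segment_at r x t) (segment_at r p t).
  rewrite /leB -segment_atB//.
  have -> : (fun s => p s - x s) = v by apply/funext => s; rewrite /p addrC addKr.
  move=> /(_ (KBv t (ltW t0))) /(_ i); rewrite !at0//.
  have -> : p t - x t = z t + d t by rewrite /p /d addrC addKr subrKC.
  rewrite mulmxDr => mono; have dxi := dx_le t t0 i.
  apply: le_trans (ler_norm_entry _ i 0).
  have -> : (Gp t - G t) i 0 = pos (G t i 0) - G t i 0 by rewrite !mxE.
  rewrite /pos /Num.max; case: ifPn => _; last by rewrite subrr.
  rewrite sub0r; apply: le_trans (ler_norm _).
  by move: mono dxi; rewrite /G /dy !mxE; lra.
move=> t t0; have d0 : forall s, s <= t -> d s = 0.
  move=> s st; have [s0|s0] := leP s 0; first exact: d_le0.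
  have qc := @continuous_segment_at R m r y yc.
  have [L [eta [L0 eta0]]] := lipschitz_near_curve sigmaP w t dF qc.
  move=> /nbhs_singleton HL.
  pose b := m%:R * `|B|; have b0 : 0 <= b by rewrite mulr_ge0.
  (* One [b] comes from the term B d in the equation of d, the other from the B d inside the bound
     on [Gp - G]. *)
  pose C := L + 2 * b; have C0 : 0 <= C by rewrite addr_ge0// mulr_ge0.
  pose M := 2 * expR ((C + 1) * t).
  have M0 : 0 < M by rewrite mulr_gt0// expR_gt0.
  apply/eqP; rewrite -normr_le0; apply/ler_addgt0Pr => e e0; rewrite add0r.
  (* The past of d is 0 and its derivative bound has no additive term, so every positive [del] is
     admissible; this one gives |d s| <= e with [e] arbitrary. *)
  pose del := Num.min e eta / M.
  have del0 : 0 < del by rewrite divr_gt0// lt_min e0.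
  have delM : 2 * del * expR ((C + 1) * t) = Num.min e eta.
    by rewrite mulrAC mulrC divfK// gt_eqF.
  apply: (@le_trans _ _ (2 * del * expR ((C + 1) * s))); last first.
    apply: (@le_trans _ _ (2 * del * expR ((C + 1) * t))).
      by rewrite ler_wpM2l ?ler_expR ?ler_wpM2l ?addr_ge0// mulr_ge0// ltW.
    by rewrite delM ge_min lexx.
  apply: (@gronwall_delay R m r t C del eta d dd) => //.
  - by move=> u _ u0; rewrite d_le0// normr0 ltW.
  - by move=> u u0 _; exact: ddP.
  - move=> u c u0 ut ceta cle.
    have du : `|d u| <= c by apply: cle => //; rewrite gerBl.
    have c0 : 0 <= c by exact: le_trans (normr_ge0 _) du.
    have Bdu : `|B *m d u| <= b * c.
      by rewrite (le_trans (ler_norm_mulmx _ _))// ler_wpM2l.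
    have pyd : segment_at r p u - segment_at r y u = segment_at r d u.
      rewrite -segment_atB//; congr (segment_at r _ u).
      by apply/funext => s'; rewrite pE addrC addKr.
    have dsu : `|segment_at r d u| <= c by exact: norm_segment_at_le.
    have Fpy : `|F (sigma u w) (segment_at r p u) - dy u| <= L * c.
      apply: (@le_trans _ _ (L * `|segment_at r p u - segment_at r y u|)).
        apply: HL; [exact: ltW|exact: ltW|by rewrite subrr normr0 ltW|].
        by rewrite distrC pyd (le_trans dsu).
      by rewrite pyd ler_wpM2l.
    have GpG : `|Gp u - G u| <= L * c + b * c.
      apply: ler_mx_norm => [|i j]; first by rewrite addr_ge0// mulr_ge0.
      rewrite ord1 ger0_norm//; apply: le_trans (Gp_le u i u0) _.
      by rewrite (le_trans (ler_normB _ _))// lerD.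
    rewrite /dd (le_trans (ler_normD _ _))//.
    apply: (@le_trans _ _ (b * c + (L * c + b * c))); first exact: lerD.
    by rewrite /C; lra.
  - by rewrite delM ge_min lexx orbT.
  - exact: ltW.
rewrite /leB -segment_atB//.
rewrite (_ : segment_at r _ t = segment_at r v t); first exact: KBv.
apply: csegP => s; rewrite in_itv/= => /andP[rs s0].
rewrite (segment_atE t zc rs s0) (segment_atE t vc rs s0).
by apply/esym/eqP; rewrite -subr_eq0; apply/eqP/d0; rewrite gerDl.
Qed.

End Comparison.

(** * Minimal flows, and the interior of the cone *)

Section MinimalFlow.
Context {R : realType} {Omega : metricType R} (sigma : R -> Omega -> Omega).
Hypothesis cptO : compact [set: Omega].
Hypothesis sigmaP : continuous_flow sigma.
Hypothesis minO : minimal_flow sigma.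

Lemma continuous_flow_space t : continuous (sigma t).
Proof.
move=> w A nA; have [sc _ _] := sigmaP.
have [[U V]/= [nU nV] UV] := sc (t, w) A nA.
by apply: filterS nV => v Vv; apply: (UV (t, v)); split=> //;
  exact: nbhs_singleton.
Qed.

(** Minimality concerns sets invariant in both time directions, while returns at positive times are
    wanted. The omega-limit set reconciles the two: it records only large times, and a fixed shift
    of either sign does not disturb the limit at infinity. *)
Lemma omega_limit_setT w : cluster (sigma s w @[s --> +oo]) = setT.
Proof.
have [_ s0 sD] := sigmaP; set K := cluster _.
have sub t p : K p -> K (sigma t p).
  move=> Kp A' B' FA nB; have nB' := continuous_flow_space nB.
  case: FA => M [Mr MA].
  have FA : (sigma s w @[s --> +oo]) (sigma t @^-1` A').
    exists (M - t); split; first exact: num_real.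
    move=> s Ms; rewrite /= -sD; apply: MA.
    by rewrite addrC -ltrBlDr.
  by have [q [Aq Bq]] := Kp _ _ FA nB'; exists (sigma t q).
apply: minO.
- by rewrite /K clusterE; apply: closed_bigI => A' _; exact: closed_closure.
- have [|p [_ Kp]] := cptO (F := sigma s w @[s --> +oo]); last by exists p.
  exact: filterT.
- move=> t; apply/seteqP; split=> [_ [p Kp <-]|p Kp]; first exact: sub.
  by exists (sigma (- t) p); [exact: sub|rewrite -sD subrr s0].
Qed.

(** Each orbit is made to hit the interior of [U], so one hitting time serves a whole neighbourhood
    of its starting point; compactness then bounds the hitting times. *)
Lemma minimal_return (w0 : Omega) (U : set Omega) : nbhs w0 U ->
  exists2 T : R, 0 <= T & forall w, exists t, [/\ 0 <= t, t <= T & U (sigma t w)].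
Proof.
move=> nU; have hit w : exists2 t, 0 <= t & nbhs (sigma t w) U.
  have Kw0 : cluster (sigma s w @[s --> +oo]) w0 by rewrite omega_limit_setT.
  have FA : (sigma s w @[s --> +oo]) [set p | exists2 s, 0 <= s & p = sigma s w].
    exists 0; split; first exact: num_real.
    by move=> s s0; exists s => //; exact: ltW.
  have [p [[s s0 ->] Up]] := Kw0 _ _ FA (nbhs_interior nU).
  by exists s.
have := (compact_near_coveringP _).1 cptO R +oo
  (fun T w => exists t, [/\ 0 <= t, t <= T & U (sigma t w)]) _.
move=> cov; have {}cov : \forall T \near +oo, [set: Omega] `<=`
    (fun w => exists t, [/\ 0 <= t, t <= T & U (sigma t w)]).
  apply: cov => w _; have [t t0 nt] := hit w.
  exists (sigma t @^-1` U, [set T | t <= T]).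
    split; first exact: (continuous_flow_space nt).
    exact: nbhs_pinfty_ge (num_real t).
  by move=> [w' T]/= [Uw' tT]; exists t.
near (+oo : set_system R) => T.
exists T; first by near: T; exact: nbhs_pinfty_ge (num_real 0).
move=> w; have : [set: Omega] `<=`
    (fun w => exists t, [/\ 0 <= t, t <= T & U (sigma t w)]) by near: T.
exact.
Unshelve. all: by end_near. Qed.

End MinimalFlow.

Section SegmentBounds.
Context {R : realType}.

Lemma bounded_segment {V : normedModType R} (f : R -> V) (a b : R) :
  continuous f -> exists2 M : R, 0 <= M &
    forall t, a <= t -> t <= b -> `|f t| <= M.
Proof.
move=> fc; have [ab|ba] := leP a b; last first.
  by exists 0 => // t at_ tb; have := le_trans at_ tb; rewrite leNgt ba.
have nc : {within `[a, b], continuous (fun t => `|f t|)}.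
  by apply: continuous_subspaceT => t; apply: cvg_norm; exact: fc.
have [c cab fle] := EVT_max ab nc.
by exists `|f c| => // t at_ tb; apply: fle; rewrite in_itv/= at_.
Qed.

Lemma positive_segment {m : nat} (u : R -> 'cV[R]_m) (a b : R) :
  continuous u -> (forall t, a <= t -> t <= b -> vlt 0 (u t)) ->
  exists2 k : R, 0 < k & forall t, a <= t -> t <= b -> forall i, k <= u t i 0.
Proof.
move=> uc u0; have [ab|ba] := leP a b; last first.
  by exists 1 => // t at_ tb; have := le_trans at_ tb; rewrite leNgt ba.
have H i : exists k : R, 0 < k /\ forall t, a <= t -> t <= b -> k <= u t i 0.
  have nc : {within `[a, b], continuous (fun t => u t i 0)}.
    by apply: continuous_subspaceT => t; apply: (cvg_mxP _ _).1; exact: uc.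
  have [c cab fle] := EVT_min ab nc; exists (u c i 0); split.
    move: cab; rewrite in_itv/= => /andP[ac cb].
    by have := u0 c ac cb i; rewrite mxE.
  by move=> t at_ tb; apply: fle; rewrite in_itv/= at_.
have [k Hk] := choice H.
near (0 : R)^'+ => e.
exists e => // t at_ tb i; have [k0 kle] := Hk i; apply: le_trans (kle t at_ tb).
move: (i); near: e; apply: filter_forall => j; apply: nbhs_right_le.
by have [] := Hk j.
Unshelve. all: by end_near. Qed.

End SegmentBounds.

(** * Interior of the cone for the Lipschitz norm *)

Section Interior.
Context {R : realType} {m : nat} {r : R} (B : 'M[R]_m).
Local Notation X := (cseg r 'cV[R]_m).
Implicit Types (phi psi : X).

Lemma XLP phi : XL phi <-> exists M : R, forall s t, s \in `[- r, 0] ->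
  t \in `[- r, 0] -> `|phi t - phi s| <= M * `|t - s|.
Proof.
split=> [/pinfty_ex_gt0[M _ HM]|[M HM]].
  by exists M => s t sr tr; exact: (HM (t, s)).
exists M; split; first exact: num_real.
move=> M' MM' [s t]/= [sr tr]; apply: (le_trans (HM t s tr sr)).
by rewrite ler_wpM2r// ltW.
Qed.

Lemma lip_const_ge phi s t : XL phi -> s \in `[- r, 0] -> t \in `[- r, 0] ->
  `|phi t - phi s| <= lip_const phi * `|t - s|.
Proof.
move=> /XLP[M HM] sr tr; have [->|st] := eqVneq s t.
  by rewrite !subrr !normr0 mulr0.
rewrite -ler_pdivrMr ?normr_gt0 ?subr_eq0 1?eq_sym//.
apply: ub_le_sup; last by exists s, t.
exists M => _ [s' [t' [s'r t'r st' ->]]].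
by rewrite ler_pdivrMr ?HM// normr_gt0 subr_eq0 eq_sym.
Qed.

Lemma lip_const_ge0 phi : 0 < r -> XL phi -> 0 <= lip_const phi.
Proof.
move=> r0 Xphi.
have r1 : - r \in `[- r, 0] by rewrite in_itv/= lexx oppr_le0 ltW.
have r2 : 0 \in `[- r, 0] by rewrite in_itv/= lexx oppr_le0 ltW.
have := lip_const_ge Xphi r1 r2; rewrite sub0r opprK (gtr0_norm r0) => H.
by have := le_trans (normr_ge0 _) H; rewrite pmulr_lge0.
Qed.

Lemma expmx_sub1_bound : exists2 C : R, 0 <= C & forall h, 0 <= h -> h <= r ->
  `|expmx (h *: B) - 1%:M| <= C * h.
Proof.
have [M M0 HM] := bounded_segment 0 r (@continuous_expmx R m B).
exists (m%:R * `|B| * M) => [|h h0 hr]; first by rewrite !mulr_ge0.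
apply: ler_mx_norm => [|i j]; first by rewrite !mulr_ge0.
have dE (s : R) : is_derive s (1 : R) (fun s => expmx (s *: B) i j)
    ((B *m expmx (s *: B)) i j).
  by apply: (is_derive_mxP _ _ _).1; exact: is_derive_expmx.
have cE : {within `[0, h], continuous (fun s => expmx (s *: B) i j)}.
  apply: continuous_subspaceT => s.
  by have [/derivable1_diffP /differentiable_continuous] := dE s.
have [s] := @MVT_segment R (fun s => expmx (s *: B) i j)
  (fun s => (B *m expmx (s *: B)) i j) 0 h h0 (fun s _ => dE s) cE.
rewrite in_itv/= subr0 scale0r expmx0 => /andP[s0 sh] eq.
rewrite subr_mxE eq normrM (ger0_norm h0) ler_wpM2r//.
apply: le_trans (ler_norm_entry _ _ _) _.
rewrite (le_trans (ler_norm_mulmx _ _))// ler_wpM2l ?mulr_ge0//.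
by apply: HM => //; exact: le_trans hr.
Qed.

(** With h = s' - s, the lower bound on u' - B u gives the cone inequality a margin [k2 * h]. A
    perturbation chi costs chi(s') - chi(s), of size e h by the Lipschitz seminorm, and (exp(hB) -
    1) chi(s), also of order e h. *)
Lemma IntKB_segment_at (u du : R -> 'cV[R]_m) t k : 0 < r ->
  quasipositive B -> continuous u -> continuous du ->
  (forall s : R, t - r < s -> s < t -> is_derive s (1 : R) u (du s)) -> 0 < k ->
  (forall s, t - r <= s -> s <= t -> forall i, k <= u s i 0) ->
  (forall s, t - r <= s -> s <= t -> forall i, k <= (du s - B *m u s) i 0) ->
  IntKB B (segment_at r u t).
Proof.
move=> r0 qB uc duc ud k0 uk duk.
have in_r s : s \in `[- r, 0] -> - r <= s /\ s <= 0.
  by rewrite in_itv/= => /andP.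
have XLu : XL (segment_at r u t).
  have [M M0 HM] := bounded_segment (t - r) t duc.
  apply/XLP; exists M => s s'.
  wlog ss' : s s' / s <= s' => [H|] sr s'r.
    have [|/ltW] := leP s s'; first by move/H; exact.
    by move/H => /(_ s'r sr); rewrite distrC [X in _ * X]distrC.
  have [rs s0] := in_r _ sr; have [rs' s'0] := in_r _ s'r.
  rewrite !segment_atE//; apply: ler_mx_norm => [|i j].
    by rewrite mulr_ge0.
  rewrite ord1 => {j}.
  have uid (x : R) : x \in `]t + s, t + s'[ ->
      is_derive x (1 : R) (fun x => u x i 0) (du x i 0).
    rewrite in_itv/= => /andP[sx xs']; apply: (is_derive_mxP _ _ _).1; apply: ud.
      by apply: le_lt_trans sx; rewrite lerD2l.
    by apply: lt_le_trans xs' _; rewrite gerDl.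
  have uic : {within `[t + s, t + s'], continuous (fun x => u x i 0)}.
    by apply: continuous_subspaceT => x; apply: (cvg_mxP _ _).1; exact: uc.
  have tss' : t + s <= t + s' by rewrite lerD2l.
  have [x] := MVT_segment tss' uid uic.
  rewrite in_itv/= => /andP[sx xs'] eq; rewrite subr_mxE eq.
  rewrite (_ : t + s' - (t + s) = s' - s); last by ring.
  rewrite normrM ler_wpM2r// (le_trans (ler_norm_entry _ _ _))// HM//.
    by apply: le_trans sx; rewrite lerD2l.
  by apply: le_trans xs' _; rewrite gerDl.
have [C C0 HC] := expmx_sub1_bound.
pose k2 := expR (- (`|B| * r)) * k.
have k20 : 0 < k2 by rewrite mulr_gt0// expR_gt0.
(* [D] adds up the two costs per unit of [e * h]. Taking e <= k2 / D protects the exponential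
   inequality, and e <= k protects nonnegativity. *)
pose D := 1 + m%:R * C; have D0 : 0 < D by rewrite ltr_wpDr// mulr_ge0.
pose e := Num.min k (k2 / D).
have e0 : 0 < e by rewrite lt_min k0 divr_gt0.
have eD : e * D <= k2 by rewrite -ler_pdivlMr// ge_min lexx orbT.
split=> //; exists e => // psi XLpsi; rewrite /XL_norm.
set phi := segment_at r u t; set chi := psi - phi => chi_e.
have XLchi : XL chi.
  have /XLP[M1 H1] := XLpsi; have /XLP[M2 H2] := XLu.
  apply/XLP; exists (M1 + M2) => s s' sr s'r.
  have -> : chi s' - chi s = (psi s' - psi s) - (phi s' - phi s).
    have E x : chi x = psi x - phi x by [].
    by rewrite !E !opprD addrACA.
  by rewrite (le_trans (ler_normB _ _))// mulrDl lerD ?H1 ?H2.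
have lip0 := lip_const_ge0 r0 XLchi.
have chi_norm : `|chi| <= e by apply: ltW; apply: le_lt_trans chi_e; rewrite lerDl.
have chi_lip : lip_const chi <= e.
  by apply: ltW; apply: le_lt_trans chi_e; rewrite lerDr.
have psiE s : psi s = phi s + chi s.
  have -> : chi s = psi s - phi s by [].
  by rewrite subrKC.
have chi_s s : s \in `[- r, 0] -> `|chi s| <= e.
  by move=> sr; apply: le_trans chi_norm; exact: cseg_norm_ge.
split=> [s sr i|s s' rs ss' s'0 i].
  have [rs s0] := in_r _ sr; rewrite psiE [leLHS]mxE mxE segment_atE//.
  have : - e <= chi s i 0.
    have := le_trans (ler_norm_entry (chi s) i 0) (chi_s s sr).
    by rewrite ler_norml => /andP[].
  have : k <= u (t + s) i 0 by apply: uk; [rewrite lerD2l|rewrite gerDl].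
  have : e <= k by rewrite ge_min lexx.
  lra.
have rs' := le_trans rs ss'; have s0 := le_trans ss' s'0.
have sr : s \in `[- r, 0] by rewrite in_itv/= rs.
have s'r : s' \in `[- r, 0] by rewrite in_itv/= rs'.
have h0 : 0 <= s' - s by rewrite subr_ge0.
have hr : s' - s <= r by rewrite -[leRHS]add0r -[r]opprK lerB.
have Hu : k2 * (s' - s) <= phi s' i 0 - (expmx ((s' - s) *: B) *m phi s) i 0.
  have tss' : t + s <= t + s' by rewrite lerD2l.
  have ts : t - r <= t + s by rewrite lerD2l.
  have ts' : t + s' <= t by rewrite gerDl.
  have := @expmx_MVT_ge R m B qB u du (t + s) (t + s') k i tss' (ltW k0) uc.
  rewrite (_ : t + s' - (t + s) = s' - s); last by ring.
  rewrite /phi !segment_atE// => H; apply: le_trans (H _ _).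
  - rewrite ler_wpM2r// ler_wpM2r ?(ltW k0)// ler_expR lerN2.
    by rewrite ler_wpM2l.
  - move=> x sx xs'; apply: ud; first exact: le_lt_trans ts sx.
    exact: lt_le_trans xs' ts'.
  - move=> x sx xs'; apply: duk; first exact: le_trans ts (ltW sx).
    exact: le_trans (ltW xs') ts'.
have Hchi : `|chi s' - chi s| <= e * (s' - s).
  apply: le_trans (lip_const_ge XLchi sr s'r) _.
  by rewrite (ger0_norm h0) ler_wpM2r.
have HE : `|(expmx ((s' - s) *: B) - 1%:M) *m chi s| <= m%:R * (C * (s' - s)) * e.
  apply: le_trans (ler_norm_mulmx _ _) _.
  by rewrite ler_pM ?mulr_ge0// ?chi_s// ler_wpM2l// HC.
rewrite !psiE mulmxDr mxE [leRHS]mxE.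
have := le_trans (ler_norm_entry _ i 0) Hchi.
rewrite subr_mxE ler_norml => /andP[Hchi' _].
have := le_trans (ler_norm_entry _ i 0) HE.
rewrite mulmxBl mul1mx subr_mxE ler_norml => /andP[_ HE'].
have : e * D * (s' - s) <= k2 * (s' - s) by rewrite ler_wpM2r.
rewrite /D; lra.
Qed.

End Interior.

(** * Sub-equilibria *)

Lemma eq_segment_at {R : realType} {m : nat} (r : R) (u v : R -> 'cV[R]_m) t t' :
  (forall s, - r <= s -> s <= 0 -> u (t + s) = v (t' + s)) ->
  segment_at r u t = segment_at r v t'.
Proof.
move=> uv; rewrite /segment_at /cseg_of; congr insubd; apply/funext => s.
by case: ifPn => //; rewrite in_itv/= => /andP[rs s0]; exact: uv.
Qed.

Lemma is_derive_translate {R : realType} {V : normedModType R} (f : R -> V)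
    (t x : R) l : is_derive (x + t) (1 : R) f l ->
  is_derive x (1 : R) (fun y => f (y + t)) l.
Proof.
move=> [df <-]; have eq : (fun k : R => k^-1 *:
    (((fun y => f (y + t)) \o shift x) (k *: (1 : R)) - f (x + t))) =
    (fun k : R => k^-1 *: ((f \o shift (x + t)) (k *: (1 : R)) - f (x + t))).
  by apply/funext => k /=; rewrite addrA.
by split; rewrite /derivable /derive eq.
Qed.

Section StrongSubEquilibrium.
Context {R : realType} {Omega : metricType R} (sigma : R -> Omega -> Omega).
Context {m : nat} {r : R} (B : 'M[R]_m).
Context (F : Omega -> cseg r 'cV[R]_m -> 'cV[R]_m) (ta : Omega -> 'cV[R]_m).
Local Notation X := (cseg r 'cV[R]_m).
Hypothesis r0 : 0 < r.
Hypothesis sigmaP : continuous_flow sigma.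
Hypothesis Fc : continuous (fun p : Omega * X => F p.1 p.2).
Hypothesis dF : C1_snd F.
Hypothesis qB : quasipositive B.
Hypothesis F_mono : forall w (phi psi : X), leB B phi psi ->
  vle (B *m (psi 0 - phi 0)) (F w psi - F w phi).
Hypothesis taC1 : C1_along sigma ta.

Let a := hist sigma r ta.

(** Freezing y at its value at -r before that time extends it continuously to the line. At t > 0
    every small increment h satisfies 0 <= t + h, so the relative derivative is two-sided. *)
Lemma global_solution_solves w phi y : global_solution sigma F w phi y ->
  exists y', [/\ solves sigma F w y', segment_at r y' 0 = phi &
    forall t, 0 <= t -> segment_at r y' t = segment_at r y t].
Proof.
move=> [yc y_phi yd]; pose p (t : R) : R := Num.max t (- r).
have pc : continuous p by exact: continuous_maxr_cst.
have pr t : - r <= p t by rewrite le_max lexx orbT.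
have pE t : - r <= t -> p t = t by move=> rt; rewrite /p max_l.
pose y' t := y (p t).
have y'c : continuous y'.
  move=> t V nV; have pt : `[- r, +oo[%classic (p t) by rewrite /= in_itv/= andbT.
  have := (subspace_continuousP _ _).1 yc _ pt V nV => W.
  have : \forall s \near t, `[- r, +oo[%classic (p s) -> V (y (p s)).
    exact: (pc t _ W).
  by apply: filterS => s; apply; rewrite /= in_itv/= andbT.
have seg t : 0 <= t -> segment_at r y' t = segment_at r y t.
  move=> t0; apply: eq_segment_at => s rs _; rewrite /y' pE//.
  by rewrite -[leLHS]add0r lerD.
exists y'; split=> //; last first.
  apply: csegP => s sr; have := sr; rewrite in_itv/= => /andP[rs s0].
  by rewrite segment_atE// add0r /y' pE// y_phi.
split=> // t t0; rewrite seg ?(ltW t0)//.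
apply: (@near_eq_is_derive R R 'cV[R]_m y).
  near=> s; rewrite /y' pE//; apply: ltW; near: s; apply: lt_nbhsr.
  by rewrite (lt_trans _ t0)// oppr_lt0.
have lim_y : h^-1 *: ((y \o shift t) (h *: (1 : R)) - y t) @[h --> (0 : R)^'] -->
    F (sigma t w) (segment_at r y t).
  move=> V nV; have := yd t (ltW t0) V nV.
  have : \forall h \near (0 : R)^', 0 <= t + h.
    apply: nbhs_dnbhs; near=> h; rewrite -lerBlDl sub0r; apply: ltW; near: h.
    by apply: lt_nbhsr; rewrite oppr_lt0.
  apply: filterS2 => h th /(_ th) /=.
  by rewrite -[h *: 1]/(h * 1) mulr1 [h + t]addrC.
split; first by apply/cvg_ex; exists (F (sigma t w) (segment_at r y t)).
exact: cvg_lim lim_y.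
Unshelve. all: by end_near. Qed.

Let x w t := ta (sigma t w).
Let dx w t := deriv_along sigma ta (sigma t w).

Lemma is_derive_along w (t : R) : is_derive t (1 : R) (x w) (dx w t).
Proof.
have [_ _ sD] := sigmaP; have [/(_ t) /derivableP d _] := taC1 w.
apply: (is_derive_eq d); rewrite -{1}(add0r t) in d.
rewrite /dx /deriv_along derive1E; have [_ <-] := is_derive_translate d.
by congr (derive _ (0 : R) (1 : R)); apply/funext => u; rewrite sD.
Qed.

Lemma continuous_along w : continuous (x w).
Proof.
move=> t; have [/derivable1_diffP /differentiable_continuous + _] :=
  is_derive_along w t.
exact.
Qed.

Lemma continuous_deriv_along w : continuous (dx w).
Proof.
have [_ dc] := taC1 w.
have -> : dx w = derive1 (fun u : R => ta (sigma u w)).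
  by apply/funext => t; rewrite derive1E; have [_ <-] := is_derive_along w t.
exact: dc.
Qed.

Lemma hist_segment_at w t : a (sigma t w) = segment_at r (x w) t.
Proof.
have [_ _ sD] := sigmaP; rewrite /a /hist /segment_at; congr cseg_of.
by apply/funext => s; rewrite /x addrC sD.
Qed.

Lemma hist_segment_at0 w : a w = segment_at r (x w) 0.
Proof. by have [_ s0 _] := sigmaP; rewrite -{1}(s0 w) hist_segment_at. Qed.

Lemma hist0 w : a w 0 = ta w.
Proof.
have [_ s0 _] := sigmaP.
rewrite hist_segment_at0 segment_atE ?addr0 /x ?s0// ?oppr_le0 1?ltW//.
exact: continuous_along.
Qed.

Lemma leB_refl (phi : X) : leB B phi phi.
Proof.
rewrite /leB subrr; split=> [s _ i|s t _ _ _ i]; first by rewrite mxE.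
by rewrite mulmx0 mxE.
Qed.

Hypothesis ta_le : forall w, vle (deriv_along sigma ta w) (F w (a w)).

Lemma hist_leB w y : solves sigma F w y -> segment_at r y 0 = a w ->
  forall t, 0 <= t -> leB B (segment_at r (x w) t) (segment_at r y t).
Proof.
move=> yS y0; apply: (comparison (ltW r0) sigmaP Fc dF qB F_mono
  (@continuous_along w) (@continuous_deriv_along w) _ _ yS).
- by move=> t _; exact: is_derive_along.
- by move=> t _; rewrite -hist_segment_at; exact: ta_le.
- by rewrite y0 hist_segment_at0; exact: leB_refl.
Qed.

Lemma hist_sub_equilibrium : globally_defined sigma F a ->
  sub_equilibrium sigma F B a.
Proof.
move=> gd; split=> // w y /global_solution_solves[y' [y'S y'0 y'y]] t t0.
by rewrite -y'y// hist_segment_at; exact: hist_leB.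
Qed.

(** * The difference between a solution and the orbit curve below it *)

Section Difference.
Variables (w : Omega) (y : R -> 'cV[R]_m).
Hypothesis yS : solves sigma F w y.
Hypothesis y0 : segment_at r y 0 = a w.

Let z t : 'cV[R]_m := y t - x w t.
Let dz t : 'cV[R]_m := F (sigma t w) (segment_at r y t) - dx w t.

Let at0 (u : R -> 'cV[R]_m) t : continuous u -> segment_at r u t 0 = u t.
Proof. by move=> uc; rewrite segment_atE ?addr0// oppr_le0 ltW. Qed.

Lemma continuous_difference : continuous z.
Proof.
by move=> t; apply: cvgB; [have [yc _] := yS; exact: yc|exact: continuous_along].
Qed.

Lemma continuous_difference_derivative : continuous dz.
Proof.
move=> t; apply: cvgB; last exact: continuous_deriv_along.
have [yc _] := yS.
exact: (continuous_vector_field sigmaP Fc yc).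
Qed.

Lemma is_derive_difference (t : R) : 0 < t -> is_derive t (1 : R) z (dz t).
Proof.
move=> t0; apply: is_deriveB; last exact: is_derive_along.
by have [_ yd] := yS; exact: yd.
Qed.

(** Now that x and y are known to be ordered, monotonicity applies to them directly: F at y exceeds
    F at x by at least B z, and F at x is at least x'. *)
Lemma difference_ge t : 0 <= t -> vle (B *m z t) (dz t).
Proof.
move=> t0 i; have [yc _] := yS; have xc := @continuous_along w.
have := F_mono (sigma t w) (hist_leB yS y0 t0) i.
rewrite !at0// => /le_trans; apply.
have := ta_le (sigma t w) i; rewrite hist_segment_at => dxi.
by rewrite !subr_mxE lerD2l lerN2.
Qed.

Lemma difference_pos_persists t t' : 0 <= t -> t <= t' ->
  vlt 0 (z t) -> vlt 0 (z t').
Proof.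
move=> t0 tt' zt i.
have tt0 : 0 <= t' - t by rewrite subr_ge0.
apply: lt_le_trans (mulmx_expmx_gt0 qB tt0 zt i) _.
apply: (@expmx_le R m B qB z dz) => //; first exact: continuous_difference.
  by move=> s ts _; apply: is_derive_difference; exact: le_lt_trans ts.
by move=> s ts _; apply: difference_ge; exact: le_trans (ltW ts).
Qed.

(** Since z vanishes at time 0, z' - B z equals F(w, a(w)) - ta'(w) there. It stays positive for a
    short time, which lifts z off 0 in every coordinate, and persistence does the rest. *)
Lemma difference_pos : vlt (deriv_along sigma ta w) (F w (a w)) ->
  forall t, 0 < t -> vlt 0 (z t).
Proof.
move=> dlt; have [_ s0 _] := sigmaP.
have zc := continuous_difference; have dzc := continuous_difference_derivative.
have z0 : z 0 = 0.
  have [yc _] := yS; have xc := @continuous_along w.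
  by rewrite /z -(at0 0 yc) -(at0 0 xc) y0 hist_segment_at0 subrr.
pose G t : 'cV[R]_m := dz t - B *m z t.
have Gc : continuous G.
  move=> t; apply: cvgB; first exact: dzc.
  by apply: cvg_mulmx; [exact: cvg_cst|exact: zc].
have Gnear i : \forall t \near (0 : R), 0 < G t i 0.
  have G0 : 0 < G 0 i 0.
    have := dlt i; rewrite -subr_gt0 /G z0 mulmx0 subr0 /dz y0 /dx s0.
    by rewrite subr_mxE.
  have Gi : G t i 0 @[t --> (0 : R)] --> G 0 i 0.
    by apply: (cvg_mxP _ _).1; exact: Gc.
  exact: (cvgr_gt _ Gi _ G0).
have : \forall t \near (0 : R), forall i, 0 < G t i 0.
  exact: filter_forall Gnear.
move=> /nbhs_ballP[d /= d0 Gd] t t0.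
pose t1 := Num.min t (d / 2).
have t10 : 0 < t1 by rewrite lt_min t0 divr_gt0.
have t1t : t1 <= t by rewrite ge_min lexx.
apply: (difference_pos_persists (ltW t10) t1t).
have := @expmx_lt R m B qB z dz 0 t1 t10 zc.
rewrite subr0 z0 mulmx0; apply.
  by move=> s s_gt0 _; exact: is_derive_difference.
move=> s s_gt0 st1 i.
have : ball 0 d s.
  rewrite /ball/= sub0r normrN gtr0_norm//; apply: lt_le_trans st1 _.
  by rewrite ge_min (_ : d / 2 <= d) ?orbT// ler_pdivrMr// ler_pMr// ler1n.
by move=> /Gd /(_ i); rewrite /G subr_mxE subr_gt0.
Qed.

Hypothesis F_strict : forall w (phi psi : X), leB B phi psi -> cseg_lt phi psi ->
  vlt (B *m (psi 0 - phi 0)) (F w psi - F w phi).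

Lemma difference_gt t : 0 <= t ->
  (forall s, t - r <= s -> s <= t -> vlt 0 (z s)) -> vlt (B *m z t) (dz t).
Proof.
move=> t0 zpos i; have [yc _] := yS; have xc := @continuous_along w.
have lt : cseg_lt (segment_at r (x w) t) (segment_at r y t).
  move=> s; rewrite in_itv/= => /andP[rs s0] j; rewrite !segment_atE//.
  have := zpos (t + s); rewrite lerD2l gerDl => /(_ rs s0) /(_ j).
  by rewrite mxE subr_mxE subr_gt0.
have := F_strict (sigma t w) (hist_leB yS y0 t0) lt i.
rewrite !at0// => /lt_le_trans; apply.
have := ta_le (sigma t w) i; rewrite hist_segment_at => dxi.
by rewrite !subr_mxE lerD2l lerN2.
Qed.

Lemma hist_ltB t : 0 <= t -> vlt 0 (z t) ->
  ltB B (a (sigma (t + 2 * r) w)) (segment_at r y (t + 2 * r)).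
Proof.
move=> t0 zt; have [yc _] := yS; have xc := @continuous_along w.
have zc := continuous_difference; have dzc := continuous_difference_derivative.
have zpos s : t <= s -> vlt 0 (z s).
  by move=> ts; exact: difference_pos_persists zt.
pose S := t + 2 * r.
have Sr s : S - r <= s -> t + r <= s by rewrite /S; lra.
have [k1 k10 Hk1] : exists2 k : R, 0 < k & forall s, S - r <= s -> s <= S ->
    forall i, k <= z s i 0.
  apply: positive_segment => // s /Sr trs _; apply: zpos.
  by apply: le_trans trs; rewrite lerDl ltW.
have [k2 k20 Hk2] : exists2 k : R, 0 < k & forall s, S - r <= s -> s <= S ->
    forall i, k <= (dz s - B *m z s) i 0.
  apply: (@positive_segment R m (fun s => dz s - B *m z s)).
    move=> s; apply: cvgB; first exact: dzc.
    by apply: cvg_mulmx; [exact: cvg_cst|exact: zc].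
  move=> s /Sr trs _ i; rewrite mxE subr_mxE subr_gt0.
  apply: difference_gt => [|s' rs' _].
    by apply: le_trans trs; rewrite addr_ge0// ltW.
  apply: zpos; apply: le_trans rs'.
  by rewrite lerBrDr.
rewrite /ltB hist_segment_at -segment_atB//.
apply: (@IntKB_segment_at R m r B z dz S (Num.min k1 k2)) => //.
- move=> s Srs _; apply: is_derive_difference.
  apply: lt_trans Srs; rewrite /S; have := r0; have := t0; lra.
- by rewrite lt_min k10.
- by move=> s Srs sS i; rewrite ge_min Hk1.
- by move=> s Srs sS i; rewrite ge_min Hk2// orbT.
Qed.

End Difference.

(** The two continuity assumptions play separate parts: the one on [a] makes the initial data close,
    so that solutions are close at time s; the one on [a \o sigma s] controls the vector subtracted
    there. *)
Lemma near_difference_pos w0 y0 s : solves sigma F w0 y0 ->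
  segment_at r y0 0 = a w0 -> 0 <= s -> vlt 0 (y0 s - ta (sigma s w0)) ->
  {for w0, continuous a} -> {for w0, continuous (a \o sigma s)} ->
  \forall w \near w0, forall y, solves sigma F w y -> segment_at r y 0 = a w ->
    vlt 0 (y s - ta (sigma s w)).
Proof.
move=> y0S y00 s0 pos ac asc.
(* The constant curve on the degenerate interval [0, 0] turns positivity of the coordinates into a
   common margin [k]. Solution and subtracted vector each use up a third of it. *)
have [k k0 Hk] := @positive_segment R m (fun=> y0 s - ta (sigma s w0)) 0 0
  (@cst_continuous _ _ _) (fun _ _ _ => pos).
have {}Hk := Hk 0 (lexx _) (lexx _).
have k3 : 0 < k / 3 by rewrite divr_gt0.
have [d d0 Hd] := continuous_dependence (ltW r0) sigmaP Fc dF s y0S k3.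
near=> w => y yS yw.
have [yc _] := yS; have [y0c _] := y0S.
have da : `|a w0 - a w| < d by near: w; exact: (cvgr_dist_lt _ _ ac).
have dsa : `|a (sigma s w0) - a (sigma s w)| < k / 3.
  by near: w; exact: (cvgr_dist_lt _ _ asc).
have dy : `|y s - y0 s| <= k / 3.
  have : forall y, solves sigma F w y ->
    (forall s, - r <= s -> s <= 0 -> `|y s - y0 s| <= d) ->
    forall t, 0 <= t -> t <= s -> `|y t - y0 t| <= k / 3 by near: w.
  apply=> // u ru u0; rewrite -[u]add0r -(segment_atE 0 yc ru u0).
  rewrite -(segment_atE 0 y0c ru u0) yw y00.
  have ur : u \in `[- r, 0] by rewrite in_itv/= ru.
  rewrite distrC; apply: le_trans (ltW da).
  exact: (cseg_norm_ge (a w0 - a w) ur).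
have dta : `|ta (sigma s w0) - ta (sigma s w)| <= k / 3.
  apply: le_trans (ltW dsa); rewrite -!hist0.
  have r00 : 0 \in `[- r, 0] by rewrite in_itv/= lexx oppr_le0 ltW.
  exact: (cseg_norm_ge (a (sigma s w0) - a (sigma s w)) r00).
move=> i; rewrite mxE subr_mxE.
have := Hk i; rewrite subr_mxE.
have := le_trans (ler_norm_entry _ i 0) dy; rewrite subr_mxE ler_norml => /andP[].
have := le_trans (ler_norm_entry _ i 0) dta; rewrite subr_mxE ler_norml => /andP[].
move: k0; lra.
Unshelve. all: by end_near. Qed.

End StrongSubEquilibrium.

Unset Implicit Arguments.

Theorem proposition2p4 (R : realType) (Omega : metricType R)
  (sigma : R -> Omega -> Omega) (m : nat) (r : R) (B : 'M[R]_m)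
  (F : Omega -> cseg r 'cV[R]_m -> 'cV[R]_m) (ta : Omega -> 'cV[R]_m) :
  compact [set: Omega] ->
  continuous_flow sigma ->
  minimal_flow sigma ->
  (0 < m)%N ->
  0 < r ->
  quasipositive B ->
  continuous (fun p : Omega * cseg r 'cV[R]_m => F p.1 p.2) ->
  C1_snd F ->
  (forall X1 : set (cseg r 'cV[R]_m), bounded_set X1 ->
     bounded_set [set F p.1 p.2 | p in [set: Omega] `*` X1]) ->
  (forall w phi psi, leB B phi psi ->
     vle (B *m (psi 0 - phi 0)) (F w psi - F w phi)) ->
  C1_along sigma ta ->
  let a : Omega -> cseg r 'cV[R]_m := hist sigma r ta in
  let hyp_i := globally_defined sigma F a /\
    forall w, vle (deriv_along sigma ta w) (F w (a w)) in
  (hyp_i -> sub_equilibrium sigma F B a) /\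
  (hyp_i ->
   (forall w phi psi, leB B phi psi -> cseg_lt phi psi ->
      vlt (B *m (psi 0 - phi 0)) (F w psi - F w phi)) ->
   (exists w0 : Omega,
      [/\ {for w0, continuous a},
          exists2 s : R, 3 * r <= s & {for w0, continuous (a \o sigma s)} &
          vlt (deriv_along sigma ta w0) (F w0 (a w0))]) ->
   strong_sub_equilibrium sigma F B a).
Proof.
move=> cptO sigmaP minO _ r0 qB Fc dF _ F_mono taC1 a hyp_i.
have partI : hyp_i -> sub_equilibrium sigma F B a.
  by move=> [gd ta_le]; exact: hist_sub_equilibrium.
split=> // -[gd ta_le] F_strict [w0 [ac [s rs asc] lt_w0]].
split; first exact: partI.
have s0 : 0 < s by apply: lt_le_trans rs; rewrite mulr_gt0.
have sol w : exists2 y, solves sigma F w y & segment_at r y 0 = a w.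
  have [y yG] := gd w.
  by have [y' [y'S y'0 _]] := global_solution_solves r0 yG; exists y'.
have [y0 y0S y00] := sol w0.
have pos := difference_pos r0 sigmaP Fc dF qB F_mono taC1 ta_le y0S y00 lt_w0 s0.
have nU := near_difference_pos r0 sigmaP Fc dF taC1 y0S y00 (ltW s0) pos ac asc.
have [T T0 HT] := minimal_return cptO sigmaP minO nU.
have [_ _ sD] := sigmaP.
exists (T + s + 2 * r); first by rewrite ltr_wpDl ?mulr_gt0// addr_ge0// ltW.
move=> w y' /(global_solution_solves r0)[y [yS yw yE]].
have Ts0 : 0 <= T + s by rewrite addr_ge0// ltW.
rewrite -yE; last by rewrite addr_ge0// mulr_ge0// ltW.
apply: (hist_ltB r0 sigmaP Fc dF qB F_mono taC1 ta_le) => //.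
have [t [t0 tT Ut]] := HT w.
have ts0 : 0 <= t + s by rewrite addr_ge0// ltW.
have tsT : t + s <= T + s by rewrite lerD2r.
apply: (difference_pos_persists r0 sigmaP Fc dF qB F_mono taC1 ta_le yS yw ts0)
  => //.
(* The neighbourhood of w0 gives information on the solution [u] issued from [a (sigma t w)], not on
   the continuation of y. Both solve the equation over sigma_t w, and the sub-equilibrium property
   orders their data, so comparison with [u] as the lower curve transfers strict positivity to y at
   time t + s. *)
have [u uS uw] := sol (sigma t w); have [uc ud] := uS; have [yc yd] := yS.
pose v x := y (x + t).
have vc : continuous v.
  move=> x; have shc : x' + t @[x' --> x] --> x + t.
    by apply: cvgD; [exact: cvg_id|exact: cvg_cst].
  exact: cvg_comp shc (yc _).
have segv x : segment_at r v x = segment_at r y (x + t).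
  by apply: eq_segment_at => z _ _; rewrite /v addrAC.
have vS : solves sigma F (sigma t w) v.
  split=> // x x0; rewrite segv -sD; apply: is_derive_translate; apply: yd.
  exact: ltr_wpDr.
have uv0 : leB B (segment_at r u 0) (segment_at r v 0).
  rewrite segv add0r uw /a hist_segment_at//.
  exact: (hist_leB r0 sigmaP Fc dF qB F_mono taC1 ta_le yS yw t0).
have := comparison (ltW r0) sigmaP Fc dF qB F_mono uc
  (continuous_vector_field sigmaP Fc uc) ud (fun _ _ i => lexx _) vS uv0 (ltW s0).
have vuc : continuous (fun x => v x - u x).
  by move=> x; apply: cvgB; [exact: vc|exact: uc].
rewrite /leB -segment_atB// => /(KB_segment_atP _ _ vuc)[+ _] i.
have ssr : s - r <= s by rewrite gerBl ltW.
move=> /(_ s ssr (lexx _) i); have := Ut u uS uw i.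
by rewrite -sD [t + s]addrC !mxE /v; lra.
Qed.
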